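(* Let $\beta$ be a one-dimensional Brownian motion, $c>0$ and $t_0\ge0$. Then, for any $0<\alpha<\frac12$ and $p\in[1,\infty]$, we have $\psi_{c,t_0}[c\beta]\in B^\alpha_{p,\infty}(\mathbb R)$ with probability one.
   Context: For $g\in C([0,\infty))$, the function $\psi_{c,t_0}[g]\in C(\mathbb R)$ is defined by $$\psi_{c,t_0}[g](t)=\begin{cases}e^{-2g(t)-2c^2t},&t\ge t_0,\\ e^{-2g(t_0)-2c^2t_0}\,(c^2(t-t_0)+1),&-\frac1{c^2}+t_0\le t<t_0,\\0,&t<-\frac1{c^2}+t_0.\end{cases}$$ (So $\psi_{c,t_0}[c\beta]$ extends the geometric Brownian motion $h_c(t)=e^{-2c\beta(t)-2c^2t}$ from $[t_0,\infty)$ to $\mathbb R$.) $B^\alpha_{p,\infty}(\mathbb R)$ is the standard inhomogeneous Besov space, with norm $\sup_{\lambda\in2^{\mathbb N_0}}\lambda^\alpha\|P_\lambda f\|_{L^p(\mathbb R)}$ for inhomogeneous Littlewood–Paley projectors $P_\lambda$ on $\mathbb R$. *)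

(* Defs.v *)
From HB Require Import structures.
From mathcomp Require Import all_boot all_order all_algebra complex.
From mathcomp Require Import all_classical all_reals all_analysis.

Set Implicit Arguments.
Unset Strict Implicit.
Unset Printing Implicit Defensive.

Import Order.TTheory GRing.Theory Num.Theory.
Import numFieldNormedType.Exports.

Local Open Scope classical_set_scope.
Local Open Scope ring_scope.

(* Time is [0, oo): only the values [B t] with [0 <= t] are constrained.  The
   start at 0 and the continuity of the paths are only required almost surely.
   In the independence clause, taking some of the [A i] to be the whole line
   gives the product rule for every subfamily of the increments. *)
Record brownian_motion (R : realType) (d : measure_display)
    (T : measurableType d) (P : probability T R) (B : R -> T -> R) : Prop :=
  BrownianMotion {
    bm_measurable : forall t : R, 0 <= t -> measurable_fun [set: T] (B t);
    bm_start : {ae P, forall w, B 0 w = 0};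
    bm_gaussian : forall (s t : R) (A : set R), 0 <= s -> s < t -> measurable A ->
      P ((fun w => B t w - B s w) @^-1` A)
      = normal_prob 0 (Num.sqrt (t - s)) A;
    bm_independent : forall (n : nat) (t : nat -> R) (A : nat -> set R),
      0 <= t 0%N -> nondecreasing_seq t -> (forall i, measurable (A i)) ->
      let increment i w := B (t i.+1) w - B (t i) w in
      P (\bigcap_(i < n) (increment i @^-1` A i))
      = (\prod_(i < n) P (increment i @^-1` A i))%E;
    bm_continuous :
      {ae P, forall w, {within `[0, +oo[, continuous (fun t => B t w)}}
  }.

Definition psi (R : realType) (c t0 : R) (g : R -> R) (t : R) : R :=
  if t0 <= t then expR (- (2 * g t) - 2 * c ^+ 2 * t)
  else if - (1 / c ^+ 2) + t0 <= t then
    expR (- (2 * g t0) - 2 * c ^+ 2 * t0) * (c ^+ 2 * (t - t0) + 1)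
  else 0.

(* Lebesgue integral over the line of a complex-valued function; as for
   [Rintegral], meaningful only when the function is integrable. *)
Definition Cintegral (R : realType) (f : R -> R[i]) : R[i] :=
  Complex (\int[lebesgue_measure]_x complex.Re (f x))%R
          (\int[lebesgue_measure]_x complex.Im (f x))%R.

(* exp (i x) *)
Definition cis (R : realType) (x : R) : R[i] := Complex (cos x) (sin x).

Definition inverse_fourier (R : realType) (m : R -> R) (x : R) : R[i] :=
  real_complex R (2 * pi)^-1 *
  Cintegral (fun xi => real_complex R (m xi) * cis (x * xi)).

Definition smooth (R : realType) (f : R -> R) : Prop :=
  forall (n : nat) (x : R), derivable (derive1n n f) x 1.

(* Cutoffs generating a Littlewood-Paley decomposition.  The radii a < b are
   left free because the usual choices differ between authors. *)
Definition lp_cutoff (R : realType) (rho : R -> R) : Prop :=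
  [/\ smooth rho,
      forall xi, 0 <= rho xi <= 1,
      forall xi, rho (- xi) = rho xi &
      exists a b : R, [/\ 0 < a, a < b,
        forall xi, `|xi| <= a -> rho xi = 1 &
        forall xi, b <= `|xi| -> rho xi = 0]].

(* Symbol of P_lambda for lambda = 2 ^ j. *)
Definition lp_symbol (R : realType) (rho : R -> R) (j : nat) (xi : R) : R :=
  match j with
  | 0 => rho xi
  | k.+1 => rho (xi / 2 ^+ k.+1) - rho (xi / 2 ^+ k)
  end.

(* The Fourier multiplier with symbol [lp_symbol rho j], written as the
   convolution with its kernel so that it makes sense for any function of
   tempered growth, whether or not it has a classical Fourier transform. *)
Definition lp_proj (R : realType) (rho : R -> R) (j : nat) (f : R -> R)
    (x : R) : R[i] :=
  Cintegral (fun y =>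
    inverse_fourier (lp_symbol rho j) (x - y) * real_complex R (f y)).

(* B^alpha_{p,oo} norm, the supremum being over lambda = 2 ^ j. *)
Definition besov_norm (R : realType) (rho : R -> R) (alpha : R) (p : \bar R)
    (f : R -> R) : \bar R :=
  ereal_sup (range (fun j : nat =>
    (((2 ^+ j) `^ alpha)%:E *
     Lnorm lebesgue_measure p
       (fun x => (ComplexField.Normc.normc (lp_proj rho j f x))%:E))%E)).

(* A measurable function of tempered growth, hence a tempered distribution. *)
Definition tempered (R : realType) (f : R -> R) : Prop :=
  exists N : nat, lebesgue_measure.-integrable [set: R]
    (fun x => (f x / (1 + `|x|) ^+ N)%:E).

(* Membership of a function in B^alpha_{p,oo}.  For 0 < alpha the elements of
   this space lie in L^p, so that [tempered] excludes none of them. *)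
Definition in_besov (R : realType) (rho : R -> R) (alpha : R) (p : \bar R)
    (f : R -> R) : Prop :=
  tempered f /\ (besov_norm rho alpha p f < +oo)%E.

(* Main.v *)
Require Import Defs.
From HB Require Import structures.
From mathcomp Require Import all_boot all_order all_algebra complex.
From mathcomp Require Import all_classical all_reals all_analysis.
From mathcomp Require Import measurable_realfun ess_sup_inf.
From mathcomp Require Import ring lra.

(** Almost every path of the extended geometric Brownian motion is Hölder
    continuous of every order below 1/2, with local Hölder constants that decay
    at infinity; such a function lies in every B^alpha_{p,oo}.  The bridge
    between the two halves is the pointwise condition [weighted_holder], with
    the quadratic weight 1 / (1 + x ^ 2):
    |f y - f x| <= D |x - y|^alpha (1 + (x - y)^2) / (1 + x^2).
    Since the weight is integrable and bounded by 1, it lies in L^p for all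
    p >= 1 at once, and a pointwise bound on the blocks P_j f by the weight
    settles every p without Minkowski's integral inequality.

    From [weighted_holder] to Besov.  Let K be the real or the imaginary part of
    the kernel of the low-frequency cutoff.  Integration by parts gives
    |K| <= C / (1 + x^2)^3 ([fourier_trig_decay]).  A change of variables shows
    that the integral J of the rescaled kernel a K(a .) is independent of a, so
    the smoothing T_a f = a K(a .) * f satisfies
    |T_a f - J f| <= M a^(-alpha) / (1 + x^2) ([approx_identity_rate]).  Every
    block is a difference of two such smoothings at adjacent scales, and
    J f cancels in it; no Fourier inversion is used to see that the kernel of a
    block has mean zero.

    From Brownian motion to [weighted_holder].  The Gaussian tail
    P(|B t - B s| > u) <= 2 exp(- u^2 / (4 (t - s))) and the Borel-Cantelli lemma
    bound, almost surely, all dyadic increments of level N on [n, n + 2] by a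
    multiple of sqrt ((n + N + 1) / 2^N) ([bm_dyadic_increments]), and give
    |B n| <= A + eps n for any eps > 0 ([bm_sublinear]).  Chaining over dyadic
    levels turns the first bound into an alpha-Hölder estimate on [n, n + 2] with
    constant of order sqrt (n + 1) ([path_holder]).  The drift - 2 c^2 t beats
    the sublinear path in the exponent, so the exponential decays exponentially
    and absorbs the growth of the Hölder constants ([gbm_local_holder]).  To the
    left of t0 the function is Lipschitz with bounded support
    ([psi_local_holder]). *)

Set Implicit Arguments.
Unset Strict Implicit.
Unset Printing Implicit Defensive.

Import Order.TTheory GRing.Theory Num.Theory.
Import numFieldNormedType.Exports.

Local Open Scope classical_set_scope.
Local Open Scope ring_scope.

(** * Lebesgue integrals on the line *)

Lemma oneDsqr_gt0 (R : realType) (x : R) : 0 < oneDsqr x.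
Proof. by rewrite (lt_le_trans _ (oneDsqr_ge1 x)). Qed.

Lemma integralT_oneDsqrV (R : realType) :
  (\int[lebesgue_measure]_x ((oneDsqr x)^-1)%:E = (pi : R)%:E)%E.
Proof.
rewrite (@ge0_symfun_integralT R (fun x => (oneDsqr x)^-1)).
- have -> : [set x : R | 0 <= x] = `[0, +oo[%classic.
    by apply/seteqP; split=> x /=; rewrite in_itv/= andbT.
  by rewrite integral0y_oneDsqr -EFinM; congr EFin; field.
- by move=> x; rewrite invr_ge0.
- exact: continuous_oneDsqrV.
- by move=> x /=; rewrite /oneDsqr sqrrN.
Qed.

Lemma ge0_integral_affine (R : realType) (G : R -> R) (a b : R) : 0 < a ->
  continuous G -> (forall x, 0 <= G x) ->
  (\int[lebesgue_measure]_x (G (a * (x + b)) * a)%:E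
   = \int[lebesgue_measure]_x (G x)%:E)%E.
Proof.
move=> a0 cG G0; pose F x := a * (x + b).
have dF (x : R) : is_derive x 1 F a.
  have -> : a = a *: (1 + 0) :> R by rewrite addr0 scaler1.
  exact: is_deriveZ.
have F'E : (F^`())%classic = cst a.
  by apply/funext => x; rewrite derive1E; apply: derive_val.
rewrite (@increasing_ge0_integration_by_substitutionT R F G)//.
- by apply: eq_integral => x _; rewrite F'E.
- by move=> x y xy; rewrite /F ltr_pM2l// ltrD2r.
- by rewrite F'E => x; exact: cvg_cst.
- by rewrite F'E; exact: is_cvg_cst.
- by rewrite F'E; exact: is_cvg_cst.
- by apply: gt0_cvgMrNy => //; exact: cvg_addrr_Ny.
- by apply: gt0_cvgMry => //; exact: cvg_addrr.
Qed.

(** For continuous integrands of any sign this holds without integrability: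
    the positive and the negative parts are continuous, and each obeys the
    nonnegative case. *)
Lemma integral_affine (R : realType) (G : R -> R) (a b : R) : 0 < a ->
  continuous G ->
  (\int[lebesgue_measure]_x (G (a * (x + b)) * a)%:E
   = \int[lebesgue_measure]_x (G x)%:E)%E.
Proof.
move=> a0 cG; rewrite integralE [in RHS]integralE.
have part (H : R -> R) : continuous H ->
    (\int[lebesgue_measure]_x (Num.max (H (a * (x + b)) * a) 0)%:E
     = \int[lebesgue_measure]_x (Num.max (H x) 0)%:E)%E.
  move=> cH; rewrite -(@ge0_integral_affine _ (fun x => Num.max (H x) 0) a b)//.
  - by apply: eq_integral => x _; rewrite maxr_pMl ?(ltW a0)// mul0r.
  - by move=> x; apply: continuous_max; [exact: cH|exact: cst_continuous].
  - by move=> x; rewrite le_max lexx orbT.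
congr (_ - _)%E.
- under eq_integral do rewrite funeposE -EFin_max.
  by under [RHS]eq_integral do rewrite funeposE -EFin_max; exact: part.
- under eq_integral do rewrite funenegE -EFinN -EFin_max -mulNr.
  under [RHS]eq_integral do rewrite funenegE -EFinN -EFin_max.
  by apply: (part (fun x => - G x)) => x; apply: continuousN; exact: cG.
Qed.

Lemma integrable_oneDsqrV (R : realType) (A : R) :
  lebesgue_measure.-integrable [set: R] (fun x => (A / oneDsqr x)%:E).
Proof.
have /(integrableZl (measurableT)) : lebesgue_measure.-integrable [set: R] (fun x : R
  => ((oneDsqr x)^-1)%:E).
  apply/integrableP; split.
    apply/measurable_EFinP; apply: continuous_measurable_fun.
    exact: continuous_oneDsqrV.
  under eq_integral do rewrite abse_EFin ger0_norm//.
  by rewrite integralT_oneDsqrV ltry.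
by move=> /(_ A); apply: eq_integrable.
Qed.

Lemma integrable_le_oneDsqrV (R : realType) (f : R -> R) (A : R) :
  measurable_fun [set: R] f -> (forall x, `|f x| <= A / oneDsqr x) ->
  lebesgue_measure.-integrable [set: R] (fun x => (f x)%:E).
Proof.
move=> mf fA; apply: (le_integrable measurableT _ _ (integrable_oneDsqrV A)).
  exact/measurable_EFinP.
move=> x _; rewrite !abse_EFin lee_fin (le_trans (fA x))//.
exact: ler_norm.
Qed.

Lemma le_normr_Rintegral_dom (R : realType) (f g : R -> R) :
  measurable_fun [set: R] f ->
  lebesgue_measure.-integrable [set: R] (fun x => (g x)%:E) ->
  (forall x, `|f x| <= g x) ->
  `|\int[lebesgue_measure]_x f x| <= \int[lebesgue_measure]_x g x.
Proof.
move=> mf ig fg.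
have jf : lebesgue_measure.-integrable [set: R] (EFin \o f).
  apply: (le_integrable measurableT _ _ ig); first exact/measurable_EFinP.
  by move=> x _; rewrite !abse_EFin lee_fin (le_trans (fg x))// ler_norm.
apply: le_trans (le_normr_Rintegral measurableT jf) _.
by apply: le_Rintegral => //; exact: integrable_norm.
Qed.

Lemma compact_support_bound (R : realType) (m : R -> R) (b : R) :
  continuous m -> (forall x, b <= `|x| -> m x = 0) ->
  exists A, forall x, `|m x| <= A / oneDsqr x.
Proof.
move=> cm mb.
have [|M [_ MP]] := @compact_bounded R R^o (m @` `[- b, b]).
  apply: continuous_compact (@segment_compact R _ _).
  exact: continuous_subspaceT.
have x0 := @oneDsqr_gt0 R.
pose B := Num.max (M + 1) 0.
have mB x : `|m x| <= B.
  have [bx|xb] := leP b `|x|; first by rewrite mb// normr0 le_max lexx orbT.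
  rewrite le_max (MP (M + 1)) ?ltrDl// /=; exists x => //=.
  by rewrite in_itv/= -ler_norml ltW.
exists (B * oneDsqr b) => x; rewrite ler_pdivlMr//.
have [bx|xb] := leP b `|x|.
  by rewrite mb// normr0 mul0r mulr_ge0 ?le_max ?lexx ?orbT// ltW.
apply: ler_pM => //.
rewrite /oneDsqr lerD2l -[x ^+ 2]real_normK ?num_real//.
by rewrite lerXn2r ?nnegrE// ?(le_trans _ (ltW xb))// ltW.
Qed.

(** * Cosine and sine transforms of test functions *)

(** For [e] = cos and [e] = sin, the real and the imaginary part of the integral
    of m(xi) exp(i x xi).  The two are treated together, through the
    properties that cos and sin share: bound 1, a parity, and e'' = - e. *)
Definition fourier_trig (R : realType) (e m : R -> R) (x : R) : R :=
  \int[lebesgue_measure]_xi (m xi * e (x * xi)).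

Definition cos_or_sin (R : realType) (e : R -> R) := e = cos \/ e = sin.

(** The equation e'' = - e, as a first-order system, is the only calculus needed
    to integrate by parts twice. *)
Lemma cos_or_sin_ode (R : realType) (e : R -> R) : cos_or_sin e ->
  exists e1 : R -> R, (forall x : R, is_derive x 1 e (e1 x)) /\
    (forall x : R, is_derive x 1 e1 (- e x)).
Proof.
case=> ->.
- exists (fun x => - sin x); split=> x; first exact: is_derive_cos.
  exact: is_deriveN.
- by exists cos; split=> x; [exact: is_derive_sin|exact: is_derive_cos].
Qed.

Lemma cos_or_sin_le1 (R : realType) (e : R -> R) x : cos_or_sin e -> `|e x| <= 1.
Proof.
by case=> ->; rewrite ler_norml ?cos_geN1 ?cos_le1// sin_geN1 sin_le1.
Qed.

Lemma cos_or_sin_continuous (R : realType) (e : R -> R) : cos_or_sin e -> continuous e.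
Proof. by case=> ->; [exact: continuous_cos|exact: continuous_sin]. Qed.

Lemma cos_or_sin_parity (R : realType) (e : R -> R) : cos_or_sin e ->
  exists s : R, forall x, e (- x) = s * e x.
Proof.
case=> ->; [exists 1|exists (-1)] => x; first by rewrite cosN mul1r.
by rewrite sinN mulN1r.
Qed.

Definition test_function (R : realType) (m : R -> R) :=
  smooth m /\ exists b, forall x, b <= `|x| -> m x = 0.

Lemma test_function_continuous (R : realType) (m : R -> R) : test_function m ->
  continuous m.
Proof.
by move=> [sm _] x; apply: differentiable_continuous; apply/derivable1_diffP;
  exact: (sm 0%N).
Qed.

(** At |x| = b itself the function need not vanish on a neighbourhood; the
    margin 1 avoids that boundary case. *)
Lemma derive_eq0_off_support (R : realType) (G : R -> R) (b x : R) :
  (forall y, b <= `|y| -> G y = 0) -> b + 1 <= `|x| -> 'D_1 G x = 0.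
Proof.
move=> Gb bx; rewrite [RHS](_ : 0 = 'D_1 (cst (0 : R)) x); last by rewrite derive_cst.
apply: near_eq_derive; near=> y; apply: Gb.
have : `|x - y| <= 1 by near: y; apply: cvgr_dist_le.
have := ler_normD (x - y) y; rewrite subrK; lra.
Unshelve. all: by end_near. Qed.

Lemma test_function_deriv (R : realType) (m : R -> R) : test_function m ->
  test_function (m^`())%classic.
Proof.
move=> [sm [b mb]]; split; first by move=> n x; rewrite -derive1Sn; exact: sm.
by exists (b + 1) => x bx; rewrite derive1E (derive_eq0_off_support mb).
Qed.

Lemma test_function_sub (R : realType) (m n : R -> R) : test_function m ->
  test_function n -> test_function (fun x => m x - n x).
Proof.
move=> [sm [b mb]] [sn [b' nb]]; split; last first.
  exists (Num.max b b') => x; rewrite ge_max => /andP[? ?].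
  by rewrite mb// nb// subrr.
have E k : derive1n k (fun x => m x - n x) = (fun x => derive1n k m x - derive1n k n x).
  elim: k => [//|k IH]; rewrite derive1nS IH; apply/funext => x.
  rewrite derive1E deriveB; [|exact: sm|exact: sn].
  by rewrite !derive1nS !derive1E.
by move=> k x; rewrite E; apply: derivableB; [exact: sm|exact: sn].
Qed.

Lemma fourier_trig_integrand_continuous (R : realType) (e m : R -> R) (x : R) :
  cos_or_sin e -> continuous m -> continuous (fun xi => m xi * e (x * xi)).
Proof.
move=> te cm xi; apply: (@continuousM R R m (fun xi => e (x * xi))); first exact: cm.
apply: (@continuous_comp R R R (fun xi => x * xi) e); last exact: cos_or_sin_continuous.
by apply: continuousM; [exact: cst_continuous|].
Qed.

Lemma fourier_trig_integrand_le (R : realType) (e m : R -> R) (x : R) xi :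
  cos_or_sin e -> `|m xi * e (x * xi)| <= `|m xi|.
Proof. by move=> te; rewrite normrM ler_piMr// cos_or_sin_le1. Qed.

Lemma test_function_integrable (R : realType) (m : R -> R) : test_function m ->
  lebesgue_measure.-integrable [set: R] (fun x => (m x)%:E).
Proof.
move=> tm; have [b mb] := tm.2.
have [A mA] := compact_support_bound (test_function_continuous tm) mb.
by apply: integrable_le_oneDsqrV mA; apply: continuous_measurable_fun;
  exact: test_function_continuous.
Qed.

Lemma fourier_trig_integrable (R : realType) (e m : R -> R) (x : R) : cos_or_sin e ->
  test_function m ->
  lebesgue_measure.-integrable [set: R] (fun xi => (m xi * e (x * xi))%:E).
Proof.
move=> te tm; apply: le_integrable (test_function_integrable tm) => //.
  apply/measurable_EFinP; apply: continuous_measurable_fun.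
  by apply: fourier_trig_integrand_continuous => //; exact: test_function_continuous.
by move=> xi _; rewrite lee_fin fourier_trig_integrand_le.
Qed.

Lemma fourier_trig_continuous (R : realType) (e m : R -> R) : cos_or_sin e ->
  test_function m ->
  continuous (fourier_trig e m).
Proof.
move=> te tm x; have xI : x \in `]x - 1, x + 1[%classic.
  by rewrite inE/= in_itv/= ltrDl ltrBlDr ltrDl ltr01.
apply: (continuity_under_integral measurableT _ _ _ _ xI).
- by move=> y _; exact: fourier_trig_integrable.
- apply: aeW => y _ z _; apply: (@continuousM R R (cst (m y)) (fun x => e (x * y))).
    exact: cst_continuous.
  apply: (@continuous_comp R R R (fun x => x * y) e); last exact: cos_or_sin_continuous.
  by apply: continuousM; [|exact: cst_continuous].
- exact: (integrable_norm (test_function_integrable tm)).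
- by move=> y _; apply: aeW => z _; exact: fourier_trig_integrand_le.
Qed.

Lemma fourier_trig_bounded (R : realType) (e m : R -> R) : cos_or_sin e ->
  test_function m ->
  exists C, forall x, `|fourier_trig e m x| <= C.
Proof.
move=> te tm; exists (\int[lebesgue_measure]_xi `|m xi|) => x.
apply: le_normr_Rintegral_dom.
- apply: continuous_measurable_fun.
  by apply: fourier_trig_integrand_continuous => //; exact: test_function_continuous.
- exact: (integrable_norm (test_function_integrable tm)).
- by move=> xi; exact: fourier_trig_integrand_le.
Qed.

Lemma fourier_trig_scale (R : realType) (e m : R -> R) (a x : R) : cos_or_sin e ->
  test_function m ->
  0 < a -> fourier_trig e (fun xi => m (xi / a)) x = a * fourier_trig e m (a * x).
Proof.
move=> te tm a0; rewrite /fourier_trig.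
pose G xi := m (xi / a) * e (x * xi).
have cG : continuous G.
  apply: (@fourier_trig_integrand_continuous _ e (fun xi => m (xi / a))) => // y.
  apply: (@continuous_comp R R R (fun y => y / a) m);
    last exact: test_function_continuous.
  by apply: continuousM; [|exact: cst_continuous].
rewrite -RintegralZl//; last exact: fourier_trig_integrable.
rewrite /Rintegral -(integral_affine 0 a0 cG); congr fine.
apply: eq_integral => y _; rewrite /G addr0 [a * y / a]mulrC mulKf ?gt_eqF//.
by rewrite mulrC (_ : x * (a * y) = a * x * y)//; ring.
Qed.

Lemma integral_derivative0 (R : realType) (G g : R -> R) (b : R) :
  (forall y : R, is_derive y 1 G (g y)) -> continuous g ->
  (forall y, b <= `|y| -> G y = 0) ->
  \int[lebesgue_measure]_y g y = 0.
Proof.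
move=> dG cg Gb; pose B := Num.max b 0 + 1.
have B0 : 0 < B by rewrite /B ltr_wpDl// le_max lexx orbT.
have gB y : B <= `|y| -> g y = 0.
  move=> By; rewrite -(@derive_val _ _ _ y 1 G (g y))//.
  apply: derive_eq0_off_support Gb _.
  by rewrite (le_trans _ By)// /B lerD2r le_max lexx.
have cG : continuous G.
  by move=> y; apply: differentiable_continuous; apply/derivable1_diffP;
    exact: (@ex_derive _ _ _ _ _ _ _ (dG y)).
rewrite (_ : \int[lebesgue_measure]_y g y = \int[lebesgue_measure]_(y in `[- B,
  B]) g y); last first.
  rewrite [RHS]Rintegral_mkcond; apply: eq_Rintegral => y _.
  rewrite patchE; case: ifPn => // /negP yB; apply: gB.
  rewrite leNgt; apply/negP => By; apply: yB.
  by rewrite inE/= in_itv/= -ler_norml ltW.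
rewrite /Rintegral (@continuous_FTC2 _ g G)//.
- by rewrite !Gb ?subee// ?normrN ger0_norm ?(ltW B0)// /B ler_wpDr// le_max lexx.
- by rewrite -subr_gt0 opprK addr_gt0.
- by apply: continuous_subspaceT.
- split.
  + by move=> y _; exact: (@ex_derive _ _ _ _ _ _ _ (dG y)).
  + by apply: cvg_at_right_filter; exact: cG.
  + by apply: cvg_at_left_filter; exact: cG.
- by move=> y _; rewrite derive1E; exact: derive_val.
Qed.

(** Two integrations by parts at once: with e_x(xi) = e(x xi), the function
    m' e_x - m e_x' has derivative (m'' + x^2 m) e_x, whose integral vanishes
    because m has bounded support. *)
Lemma fourier_trig_oneDsqr (R : realType) (e m : R -> R) (x : R) : cos_or_sin e ->
  test_function m ->
  oneDsqr x * fourier_trig e m x = fourier_trig e (fun xi =>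
    m xi - (m^`()^`())%classic xi) x.
Proof.
move=> te tm; have [e1 [de de1]] := cos_or_sin_ode te.
have tm1 := test_function_deriv tm; have tm2 := test_function_deriv tm1.
have tmm := test_function_sub tm tm2.
have dm (k : R -> R) (y : R) : test_function k -> is_derive y 1 k (k^`()%classic y).
  by move=> tk; rewrite derive1E; apply/derivableP; exact: (tk.1 0%N).
have dxy (y : R) : is_derive y 1 (fun xi : R => x * xi) x.
  apply: is_derive_eq (is_deriveZ x (is_derive_id y (1 : R))) _.
  by rewrite /GRing.scale/= mulr1.
have dex (y : R) : is_derive y 1 (fun xi : R => e (x * xi)) (e1 (x * y) * x).
  exact: (@is_derive1_comp R e (fun xi => x * xi) y _ _ (de _) (dxy y)).
have de1x (y : R) : is_derive y 1 (fun xi : R => e1 (x * xi)) (- e (x * y) * x).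
  exact: (@is_derive1_comp R e1 (fun xi => x * xi) y _ _ (de1 _) (dxy y)).
pose G y := (m^`())%classic y * e (x * y) - x * (m y * e1 (x * y)).
pose g y := ((m^`()^`())%classic y + x ^+ 2 * m y) * e (x * y).
have dG (y : R) : is_derive y 1 G (g y).
  have h1 := is_deriveM (dm _ y tm1) (dex y).
  have h2 := is_deriveM (dm _ y tm) (de1x y).
  have h3 := is_deriveB h1 (is_deriveZ x h2).
  apply: is_derive_eq h3 _.
  rewrite /g /GRing.scale/=; ring.
have [b mb] := tm.2; have [b' m'b] := tm1.2.
have g0 : \int[lebesgue_measure]_y g y = 0.
  apply: (integral_derivative0 dG (b := Num.max b b')).
    apply: (@fourier_trig_integrand_continuous _ e (fun y =>
      (m^`()^`())%classic y + x ^+ 2 * m y)) => // y.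
    apply: (@continuousD R R^o R^o); first exact: test_function_continuous.
    by apply: continuousM; [exact: cst_continuous|exact: test_function_continuous].
  by move=> y; rewrite ge_max => /andP[? ?]; rewrite /G mb// m'b// !mul0r mulr0 subr0.
apply/eqP; rewrite -subr_eq0 /fourier_trig -RintegralZl//;
  last exact: fourier_trig_integrable.
rewrite -RintegralB//; last 2 first.
  exact: (integrableZl _ _ (fourier_trig_integrable x te tm)).
  exact: (fourier_trig_integrable x te tmm).
apply/eqP; rewrite -[RHS]g0; apply: eq_Rintegral => y _.
by rewrite /g /oneDsqr; ring.
Qed.

(** Multiplication by 1 + x^2 corresponds to m |-> m - m'', which preserves test
    functions; three applications give the cube.  One power of 1 + x^2 is
    consumed by the Hölder factor, one by the shift of the weight, and the last
    one makes the kernel integrable. *)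
Lemma fourier_trig_decay (R : realType) (e m : R -> R) : cos_or_sin e ->
  test_function m ->
  exists2 C, 0 <= C & forall x, `|fourier_trig e m x| <= C / oneDsqr x ^+ 3.
Proof.
move=> te tm.
have tL k : test_function k -> test_function (fun xi =>
  k xi - (k^`()^`())%classic xi : R).
  by move=> tk; apply: (test_function_sub tk); do 2 apply: test_function_deriv.
have t1 := tL _ tm; have t2 := tL _ t1; have t3 := tL _ t2.
have [C FC] := fourier_trig_bounded te t3.
exists C; first exact: le_trans (FC 0).
move=> x; rewrite ler_pdivlMr ?exprn_gt0 ?oneDsqr_gt0//.
rewrite -[X in _ * X]ger0_norm ?exprn_ge0// -normrM mulrC !exprS expr0 mulr1 -!mulrA.
by rewrite !fourier_trig_oneDsqr.
Qed.

(** * Approximate identities on weighted Hölder functions *)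

Lemma powR_le_oneDsqr (R : realType) (a u : R) : 0 <= a <= 2 ->
  `|u| `^ a <= oneDsqr u.
Proof.
move=> /andP[a0 a2]; have [u1|u1] := leP `|u| 1.
  apply: (@le_trans _ _ 1); last exact: oneDsqr_ge1.
  apply: (@le_trans _ _ (1 `^ a)); last by rewrite powR1.
  by rewrite ge0_ler_powR// ?nnegrE.
apply: (@le_trans _ _ (`|u| `^ 2)); first by rewrite ler_powR// ltW.
by rewrite powR_mulrn// real_normK ?num_real// /oneDsqr lerDr.
Qed.

(** The factor [oneDsqr (x - y)] is the price of moving the weight from [y] to
    [x] (Peetre's inequality); it makes the condition meaningful for distant
    points too. *)
Definition weighted_holder (R : realType) (alpha D : R) (f : R -> R) :=
  (forall x, `|f x| <= D / oneDsqr x) /\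
  (forall x y, `|f y - f x| <= D * `|x - y| `^ alpha * oneDsqr (x - y) / oneDsqr x).

Lemma weighted_holder_ge0 (R : realType) (alpha D : R) (f : R -> R) :
  weighted_holder alpha D f -> 0 <= D.
Proof.
move=> [fD _]; have := le_trans (normr_ge0 _) (fD 0).
by rewrite pmulr_lge0// invr_gt0 oneDsqr_gt0.
Qed.

(** At distance at most 1 the Hölder bound is at most 2 D |x - y|^alpha. *)
Lemma weighted_holder_continuous (R : realType) (alpha D : R) (f : R -> R) :
  0 < alpha -> weighted_holder alpha D f -> continuous f.
Proof.
move=> a0 wf x; have D0 := weighted_holder_ge0 wf; have fH := wf.2.
apply/(@cvgrPdist_le R R^o) => eps eps0; near=> y; rewrite distrC.
have xy1 : `|x - y| <= 1 by near: y; apply: cvgr_dist_le.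
have xyd : `|x - y| <= (eps / (2 * (D + 1))) `^ alpha^-1.
  near: y; apply: cvgr_dist_le => //;
    rewrite powR_gt0// divr_gt0// mulr_gt0// ltr_wpDl//.
apply: (le_trans (fH x y)).
apply: (@le_trans _ _ ((D + 1) * (eps / (2 * (D + 1))) * 2)); last first.
  by rewrite le_eqVlt; apply/orP; left; apply/eqP; field; rewrite gt_eqF// ltr_wpDl.
rewrite -[leRHS]divr1; apply: ler_pM => //.
- by rewrite !mulr_ge0// powR_ge0.
- apply: ler_pM => //; first by rewrite mulr_ge0// powR_ge0.
    apply: ler_pM; rewrite ?powR_ge0 ?lerDl//.
    have -> : eps / (2 * (D + 1)) = ((eps / (2 * (D + 1))) `^ alpha^-1) `^ alpha.
      by rewrite -powRrM mulVf ?gt_eqF// powRr1// divr_ge0 ?mulr_ge0 ?ltW// ltr_wpDl.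
    by rewrite ge0_ler_powR ?nnegrE ?powR_ge0// ltW.
  rewrite /oneDsqr -[X in 1 + X]real_normK ?num_real// -[leRHS]/(1 + 1) lerD2l.
  by rewrite expr_le1.
- by rewrite lef_pV2 ?posrE ?oneDsqr_gt0 ?oneDsqr_ge1.
Unshelve. all: by end_near. Qed.

(** The right-hand side does not depend on the scale [a]: this is what makes the
    kernels of the Littlewood-Paley blocks have mean zero.  The parity of [K]
    replaces the reflection y |-> x - y by an increasing substitution. *)
Lemma integral_rescaled_kernel (R : realType) (K : R -> R) (s a x : R) :
  continuous K -> (forall x, K (- x) = s * K x) -> 0 < a ->
  (\int[lebesgue_measure]_y (a * K (a * (x - y)))%:E
   = \int[lebesgue_measure]_y (s * K y)%:E)%E.
Proof.
move=> cK Ks a0.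
rewrite -(@integral_affine _ (fun y => s * K y) a (- x)) //.
  apply: eq_integral => y _; rewrite -Ks -mulrN opprB mulrC //.
by move=> y; apply: continuousM; [exact: cst_continuous|exact: cK].
Qed.

(** Write the difference as the integral of a K(a (x - y)) (f y - f x).  With
    u = a (x - y), the Hölder factor is a^(-alpha) |u|^alpha, and both |u|^alpha
    and 1 + (x - y)^2 are at most 1 + u^2 since a >= 1; against
    |K u| <= C / (1 + u^2)^3 this leaves a / (1 + u^2), of integral pi. *)
Lemma approx_identity_rate (R : realType) (K f : R -> R) (s C D alpha : R) :
  continuous K -> (forall x, K (- x) = s * K x) -> 0 <= C ->
  (forall x, `|K x| <= C / oneDsqr x ^+ 3) ->
  0 < alpha <= 2 -> weighted_holder alpha D f ->
  forall a x, 1 <= a ->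
  lebesgue_measure.-integrable [set: R]
    (fun y => (a * K (a * (x - y)) * f y)%:E) /\
  `|\int[lebesgue_measure]_y (a * K (a * (x - y)) * f y)
    - \int[lebesgue_measure]_y (s * K y) * f x|
  <= C * D * pi * a `^ (- alpha) / oneDsqr x.
Proof.
move=> cK Ks C0 KC /andP[alpha0 alpha2] fH a x a1.
have a0 : 0 < a by rewrite (lt_le_trans _ a1).
have cf := weighted_holder_continuous alpha0 fH.
have D0 := weighted_holder_ge0 fH; case: fH => fD fH.
have caK : continuous (fun y => a * K (a * (x - y))).
  move=> y; apply: continuousM; first exact: cst_continuous.
  apply: (@continuous_comp R R R (fun y => a * (x - y)) K); last exact: cK.
  apply: continuousM; first exact: cst_continuous.
  by apply: (@continuousB R R^o R^o); [exact: cst_continuous|].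
have caKf : continuous (fun y : R => a * K (a * (x - y)) * f y).
  by move=> y; apply: (@continuousM R R (fun y => a * K (a * (x - y))) f);
    [exact: caK|exact: cf].
have cW : continuous (fun y : R => (oneDsqr (a * (y - x)))^-1 * a).
  move=> y; apply: (@continuousM R R (fun y => (oneDsqr (a * (y - x)))^-1) (cst a));
    last exact: cst_continuous.
  apply: (@continuous_comp R R R (fun y => a * (y - x)) (fun z => (oneDsqr z)^-1));
    last exact: continuous_oneDsqrV.
  apply: continuousM; first exact: cst_continuous.
  by apply: (@continuousB R R^o R^o); [|exact: cst_continuous].
have iW : lebesgue_measure.-integrable [set: R]
    (fun y => ((oneDsqr (a * (y - x)))^-1 * a)%:E).
  apply/integrableP; split.
    by apply/measurable_EFinP; exact: continuous_measurable_fun.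
  under eq_integral do rewrite abse_EFin ger0_norm ?mulr_ge0 ?invr_ge0// ?ltW//.
  rewrite (@ge0_integral_affine _ (fun z => (oneDsqr z)^-1) a (- x))//; last first.
    exact: continuous_oneDsqrV.
  by rewrite integralT_oneDsqrV ltry.
have W y : oneDsqr (a * (x - y)) = oneDsqr (a * (y - x)).
  by rewrite /oneDsqr -opprB mulrN sqrrN.
have aKW y : `|a * K (a * (x - y))| <= C * ((oneDsqr (a * (y - x)))^-1 * a).
  rewrite normrM (gtr0_norm a0) mulrC mulrA ler_wpM2r ?(ltW a0)//.
  rewrite (le_trans (KC _))// W ler_wpM2l// lef_pV2 ?posrE ?exprn_gt0 ?oneDsqr_gt0//.
  by rewrite ler_eXnr// oneDsqr_ge1.
have iaK : lebesgue_measure.-integrable [set: R] (fun y => (a * K (a * (x - y)))%:E).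
  apply: (le_integrable measurableT _ _ (integrableZl measurableT C iW)).
    by apply/measurable_EFinP; apply: continuous_measurable_fun.
  move=> y _; rewrite -EFinM !abse_EFin lee_fin (le_trans (aKW y))// ler_norm//.
have iaKf : lebesgue_measure.-integrable [set: R] (fun y =>
  (a * K (a * (x - y)) * f y)%:E).
  apply: (le_integrable measurableT _ _ (integrableZl measurableT (C * D) iW)).
    by apply/measurable_EFinP; exact: continuous_measurable_fun.
  move=> y _; rewrite -EFinM !abse_EFin lee_fin [leLHS]normrM [leLHS]mulrC.
  have fD' : `|f y| <= D.
    rewrite (le_trans (fD y))// ler_pdivrMr ?oneDsqr_gt0// ler_peMr//.
  rewrite (le_trans (ler_pM _ _ fD' (aKW y)))// mulrA [D * C]mulrC ler_norm//.
split=> //.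
rewrite (_ : \int[lebesgue_measure]_y (s * K y) = \int[lebesgue_measure]_y (a * K (a *
  (x - y)))); last first.
  by rewrite /Rintegral (@integral_rescaled_kernel _ K s a x).
rewrite -RintegralZr// -RintegralB//; last first.
  by have := integrableZr measurableT (f x) iaK.
pose g y := C * D * a `^ (- alpha) / oneDsqr x * ((oneDsqr (a * (y - x)))^-1 * a).
have -> : C * D * pi * a `^ (- alpha) / oneDsqr x = \int[lebesgue_measure]_y g y.
  rewrite RintegralZl// /Rintegral (@ge0_integral_affine _ (fun z =>
    (oneDsqr z)^-1) a (- x))//; last first.
    exact: continuous_oneDsqrV.
  by rewrite integralT_oneDsqrV/=; ring.
apply: le_normr_Rintegral_dom.
- apply: measurable_funB; apply: continuous_measurable_fun => //= y.
  apply: (@continuousM R R (fun y => a * K (a * (x - y))) (cst (f x)));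
    first exact: caK.
  exact: cst_continuous.
- by have := integrableZl measurableT (C * D * a `^ (- alpha) / oneDsqr x) iW.
move=> y; rewrite -mulrBr normrM.
set z := x - y; set u := oneDsqr (a * z).
have u0 : 0 < u by exact: oneDsqr_gt0.
have zu : `|z| `^ alpha <= a `^ (- alpha) * u.
  have -> : `|z| = a^-1 * `|a * z|.
    by rewrite normrM gtr0_norm// mulKf// gt_eqF.
  rewrite powRM ?invr_ge0 ?(ltW a0)// -powR_inv1 ?(ltW a0)// -powRrM mulN1r.
  by rewrite ler_wpM2l ?powR_ge0// powR_le_oneDsqr// ltW.
have zu' : oneDsqr z <= u.
  rewrite /u /oneDsqr lerD2l exprMn ler_peMl ?sqr_ge0//.
  by rewrite exprn_ege1.
have hK : `|a * K (a * z)| <= a * (C / u ^+ 3).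
  by rewrite normrM (gtr0_norm a0) ler_wpM2l ?(ltW a0)// KC.
have hf : `|f y - f x| <= D * (a `^ (- alpha) * u) * u / oneDsqr x.
  rewrite (le_trans (fH x y))// ler_wpM2r ?invr_ge0//.
  rewrite ler_pM ?mulr_ge0 ?powR_ge0//.
  by rewrite ler_wpM2l.
rewrite (le_trans (ler_pM _ _ hK hf))// /g.
have -> : oneDsqr (a * (y - x)) = u by rewrite /u W.
rewrite le_eqVlt; apply/orP; left; apply/eqP; field.
by rewrite !gt_eqF ?oneDsqr_gt0.
Qed.

(** * Littlewood-Paley blocks and the Besov norm *)

Lemma test_function_scale (R : realType) (m : R -> R) (a : R) : 0 < a ->
  test_function m ->
  test_function (fun xi => m (xi / a)).
Proof.
move=> a0 [sm [b mb]]; split; last first.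
  exists (b * a) => x bx; apply: mb.
  by rewrite normrM (gtr0_norm (_ : 0 < a^-1)) ?invr_gt0// ler_pdivlMr.
have dlin (x : R) : is_derive x 1 (fun y : R => y / a) a^-1.
  apply: is_derive_eq (is_deriveM (is_derive_id x (1 : R)) (is_derive_cst a^-1 x 1)) _.
  by rewrite /GRing.scale/= mulr0 add0r mulr1.
have D k (x : R) : is_derive x 1 (fun xi : R => a^-1 ^+ k * derive1n k m (xi / a))
    (a^-1 ^+ k.+1 * derive1n k.+1 m (x / a)).
  have dk : is_derive (x / a) 1 (derive1n k m) (derive1n k.+1 m (x / a)).
    by rewrite derive1nS derive1E; apply/derivableP; exact: sm.
  have h := @is_derive1_comp R (derive1n k m) (fun y => y / a) x _ _ dk (dlin x).
  apply: is_derive_eq (is_deriveZ (a^-1 ^+ k) h) _.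
  by rewrite /GRing.scale/= exprSr -mulrA [_ * a^-1]mulrC.
have E k : derive1n k (fun xi => m (xi / a)) = (fun xi =>
  a^-1 ^+ k * derive1n k m (xi / a)).
  elim: k => [|k IH]; first by apply/funext => xi; rewrite expr0 mul1r.
  by rewrite derive1nS IH; apply/funext => xi; rewrite derive1E; apply: derive_val.
by move=> k x; rewrite E; exact: (@ex_derive _ _ _ _ _ _ _ (D k x)).
Qed.

(** The block of index k + 1 is the difference of the smoothings at scales
    2^(k+1) and 2^k, in which the common main term J f cancels; the block of
    index 0 is a single smoothing, and J f is itself bounded by the weight. *)
Lemma lp_proj_component_le (R : realType) (e rho f : R -> R) (alpha D : R) :
  cos_or_sin e -> test_function rho -> 0 < alpha <= 1 -> weighted_holder alpha D f ->
  exists M, forall j x,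
  `|\int[lebesgue_measure]_y ((2 * pi)^-1 * fourier_trig e (lp_symbol rho j) (x - y) *
    f y)|
  <= M * (2 ^+ j) `^ (- alpha) / oneDsqr x.
Proof.
move=> te tr /andP[alpha0 alpha1] fH.
have [s es] := cos_or_sin_parity te.
have [C C0 Cft] := fourier_trig_decay te tr.
pose K z : R := (2 * pi)^-1 * fourier_trig e rho z.
have pi2 : 0 <= (2 * pi)^-1 :> R by rewrite invr_ge0 mulr_ge0// pi_ge0.
have cK : continuous K.
  move=> z; apply: (@continuousM R R (cst _) (fourier_trig e rho));
    first exact: cst_continuous.
  exact: fourier_trig_continuous.
have Ks z : K (- z) = s * K z.
  rewrite /K mulrCA; congr (_ * _); rewrite /fourier_trig -RintegralZl//;
    last exact: fourier_trig_integrable.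
  by apply: eq_Rintegral => xi _; rewrite mulNr es mulrCA.
have KC z : `|K z| <= (2 * pi)^-1 * C / oneDsqr z ^+ 3.
  by rewrite /K normrM (ger0_norm pi2) -mulrA ler_wpM2l// Cft.
have alpha02 : 0 < alpha <= 2 by rewrite alpha0 (le_trans alpha1)// ler1n.
have AI := approx_identity_rate cK Ks (mulr_ge0 pi2 C0) KC alpha02 fH.
move: AI; set J := \int[lebesgue_measure]_y (s * K y); set B := _ * D * pi => AI.
have D0 := weighted_holder_ge0 fH.
have B0 : 0 <= B by rewrite !mulr_ge0// pi_ge0.
have two1 (k : nat) : 1 <= 2 ^+ k :> R by rewrite exprn_ege1// ler1n.
have two0 (k : nat) : 0 < 2 ^+ k :> R by rewrite exprn_gt0.
exists (`|J| * D + 3 * B) => -[|k] x.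
  have [_ b] := AI 1 x (lexx 1).
  rewrite expr0 powR1 mulr1.
  rewrite (_ : \int[lebesgue_measure]_y _ = \int[lebesgue_measure]_y (1 * K (1 * (x -
    y)) * f y)); last first.
    by apply: eq_Rintegral => y _; rewrite !mul1r.
  rewrite -[X in `|X|](subrK (J * f x)) (le_trans (ler_normD _ _))//.
  rewrite mulrDl addrC lerD//.
    by rewrite normrM -mulrA ler_wpM2l// fH.1.
  rewrite (le_trans b)// powR1 mulr1 ler_wpM2r// ?invr_ge0//; lra.
have [i1 b1] := AI _ x (two1 k.+1); have [i0 b0] := AI _ x (two1 k).
have E y : (2 * pi)^-1 * fourier_trig e (lp_symbol rho k.+1) (x - y) * f y
    = 2 ^+ k.+1 * K (2 ^+ k.+1 * (x - y)) * f y - 2 ^+ k * K (2 ^+ k * (x - y)) * f y.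
  rewrite -mulrBl; congr (_ * _).
  have ts n : test_function (fun xi : R => rho (xi / 2 ^+ n)).
    by apply: test_function_scale => //; exact: two0.
  rewrite /K !(mulrCA (2 ^+ _)) -mulrBr -!fourier_trig_scale//; congr (_ * _).
  rewrite /fourier_trig -RintegralB//;
    [|exact: fourier_trig_integrable|exact: fourier_trig_integrable].
  by apply: eq_Rintegral => xi _; rewrite /= mulrBl.
under eq_Rintegral do rewrite E.
rewrite RintegralB//.
set T1 := \int[_]_x _ in b1 *; set T0 := \int[_]_x _ in b0 *.
have -> : T1 - T0 = (T1 - J * f x) - (T0 - J * f x) by ring.
rewrite (le_trans (ler_normB _ _))// (le_trans (lerD b1 b0))//.
rewrite -mulrDl ler_wpM2r// ?invr_ge0// -mulrDr.
have half : (2 ^+ k) `^ (- alpha) <= 2 * (2 ^+ k.+1) `^ (- alpha) :> R.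
  rewrite exprS powRM ?ler0n ?(ltW (two0 _))// mulrA ler_peMl ?powR_ge0//.
  rewrite powRN -ler_pdivrMr ?div1r ?invr_gt0 ?powR_gt0// invrK.
  by rewrite -[leRHS]powRr1// ler_powR// ler1n.
apply: (@le_trans _ _ (B * (3 * (2 ^+ k.+1) `^ (- alpha)))).
  by rewrite ler_wpM2l//; lra.
rewrite mulrA ler_wpM2r ?powR_ge0// [B * 3]mulrC lerDr mulr_ge0//.
Qed.

Lemma normc_le (R : realType) (a b : R) :
  ComplexField.Normc.normc (Complex a b) <= `|a| + `|b|.
Proof.
rewrite /= -[leRHS]ger0_norm ?addr_ge0// -sqrtr_sqr ler_sqrt ?sqr_ge0//.
rewrite -[a ^+ 2]real_normK ?num_real// -[b ^+ 2]real_normK ?num_real//.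
rewrite sqrrD -addrA [_ *+ 2 + _]addrC addrA lerDl mulrn_wge0// mulr_ge0//.
Qed.

Lemma lp_proj_pointwise_le (R : realType) (rho f : R -> R) (alpha D : R) :
  lp_cutoff rho -> 0 < alpha <= 1 -> weighted_holder alpha D f ->
  exists M, forall j x,
  ComplexField.Normc.normc (lp_proj rho j f x) <= M * (2 ^+ j) `^ (- alpha) / oneDsqr x.
Proof.
move=> [sr _ _ [_ [b [_ _ _ rb]]]] a01 fH.
have tr : test_function rho by split=> //; exists b.
have [M1 H1] := lp_proj_component_le (or_introl erefl : cos_or_sin cos) tr a01 fH.
have [M2 H2] := lp_proj_component_le (or_intror erefl : cos_or_sin sin) tr a01 fH.
exists (M1 + M2) => j x; rewrite /lp_proj /Cintegral (le_trans (normc_le _ _))//.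
rewrite !mulrDl lerD//.
- apply: le_trans (H1 j x); rewrite le_eqVlt; apply/orP; left; apply/eqP; congr `|_|.
  apply: eq_Rintegral => y _; rewrite /inverse_fourier /Cintegral /=.
  rewrite !(mul0r, mulr0, subr0, addr0, add0r).
  by under eq_Rintegral do rewrite !(mul0r, mulr0, subr0, addr0).
- apply: le_trans (H2 j x); rewrite le_eqVlt; apply/orP; left; apply/eqP; congr `|_|.
  apply: eq_Rintegral => y _; rewrite /inverse_fourier /Cintegral /=.
  rewrite !(mul0r, mulr0, subr0, addr0, add0r).
  by under eq_Rintegral do rewrite !(mul0r, mulr0, subr0, addr0).
Qed.

(** Monotonicity without measurability: the integral of a nonnegative function is
    a supremum over the simple functions below it.  It is used for the p-th
    powers of the blocks, whose measurability then need not be discussed. *)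
Lemma le_ge0_integral (d : measure_display) (T : measurableType d) (R : realType)
    (mu : {measure set T -> \bar R}) (f g : T -> \bar R) :
  (forall x, (0 <= f x)%E) -> (forall x, (f x <= g x)%E) ->
  (\int[mu]_x f x <= \int[mu]_x g x)%E.
Proof.
move=> f0 fg.
have g0 x : (0 <= g x)%E by exact: le_trans (f0 x) (fg x).
rewrite !ge0_integralTE//; apply: le_ereal_sup => _ [h hf <-].
by exists h => // x; exact: le_trans (hf x) (fg x).
Qed.

Lemma pi_ge1 (R : realType) : 1 <= pi :> R.
Proof. by have := @pi_ge2 R; lra. Qed.

(** The weight is at most 1, so its p-th power is at most itself and has
    integral at most pi; the factor pi >= 1 also covers p = +oo. *)
Lemma Lnorm_oneDsqr_le (R : realType) (p : \bar R) (g : R -> R) (A : R) :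
  (1 <= p)%E -> (forall x, 0 <= g x) -> (forall x, g x <= A / oneDsqr x) ->
  (Lnorm lebesgue_measure p (fun x => (g x)%:E) <= (A * pi)%:E)%E.
Proof.
move=> p1 g0 gA.
have A0 : 0 <= A by have := le_trans (g0 0) (gA 0);
  rewrite pmulr_lge0// invr_gt0 oneDsqr_gt0.
have gA' x : g x <= A.
  by rewrite (le_trans (gA x))// ler_pdivrMr ?oneDsqr_gt0// ler_peMr.
have pi0 := pi_ge0 R; have pi1 := pi_ge1 R.
rewrite unlock; case: p p1 => [r|_|//]; last first.
  case: ifPn => // _; last by rewrite lee_fin mulr_ge0.
  apply/ess_supP/aeW => x /=; rewrite lee_fin ger0_norm// (le_trans (gA' x))//.
  by rewrite ler_peMr.
rewrite lee_fin => r1.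
have r0 : 0 < r by rewrite (lt_le_trans _ r1).
have -> : (A * pi)%:E = (((A * pi) `^ r)%:E `^ r^-1)%E.
  by rewrite poweR_EFin -powRrM mulfV ?gt_eqF// powRr1// mulr_ge0.
apply: gt0_ler_poweR; rewrite ?invr_ge0 ?(ltW r0)//.
- by rewrite in_itv/= integral_ge0 ?leey// => x _; exact: poweR_ge0.
- by rewrite in_itv/= leey lee_fin powR_ge0.
apply: (@le_trans _ _ (\int[lebesgue_measure]_x (A `^ r / oneDsqr x)%:E)%E).
  apply: le_ge0_integral => x; first exact: poweR_ge0.
  rewrite abse_EFin poweR_EFin lee_fin ger0_norm//.
  apply: (@le_trans _ _ ((A / oneDsqr x) `^ r));
    first by rewrite ge0_ler_powR// ?nnegrE ?divr_ge0// ltW.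
  rewrite powRM ?invr_ge0// ler_wpM2l ?powR_ge0//.
  rewrite -[leRHS]powRr1 ?invr_ge0// ger_powR// invr_gt0 oneDsqr_gt0/=.
  by rewrite invf_le1// oneDsqr_gt0.
under eq_integral do rewrite EFinM.
rewrite ge0_integralZl//=; last 2 first.
- by apply/measurable_EFinP; apply: continuous_measurable_fun;
  exact: continuous_oneDsqrV.
- by rewrite lee_fin powR_ge0.
rewrite integralT_oneDsqrV -EFinM lee_fin powRM// ler_wpM2l ?powR_ge0//.
by rewrite -[leLHS]powRr1// ler_powR.
Qed.

Lemma weighted_holder_in_besov (R : realType) (rho f : R ->
  R) (alpha D : R) (p : \bar R) :
  lp_cutoff rho -> 0 < alpha <= 1 -> (1 <= p)%E -> weighted_holder alpha D f ->
  in_besov rho alpha p f.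
Proof.
move=> hrho a01 p1 fH; split.
  exists 0%N; under eq_fun do rewrite expr0 divr1.
  apply: integrable_le_oneDsqrV fH.1; apply: continuous_measurable_fun.
  by apply: weighted_holder_continuous fH; case/andP: a01.
have [M HM] := lp_proj_pointwise_le hrho a01 fH.
rewrite /besov_norm; apply: (@le_lt_trans _ _ (M * pi)%:E); last exact: ltry.
apply: ge_ereal_sup => _ [j _ <-].
have q0 : 0 < (2 ^+ j) `^ alpha :> R by rewrite powR_gt0// exprn_gt0.
rewrite muleC -lee_pdivlMr// -EFinM.
rewrite (_ : M * pi / (2 ^+ j) `^ alpha = M * (2 ^+ j) `^ (- alpha) * pi);
  last by rewrite powRN; ring.
apply: Lnorm_oneDsqr_le => // x.
by case: (lp_proj _ _ _ _) => a b; exact: sqrtr_ge0.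
Qed.

(** * Gaussian tails and Brownian increments *)

Lemma measurable_normr_gt (R : realType) (u : R) :
  measurable [set x : R | u < `|x|].
Proof.
have := @normr_measurable R setT measurableT `]u, +oo[%classic (measurable_itv _).
by rewrite setTI; congr measurable; apply/seteqP; split=> x /=; rewrite in_itv/= andbT.
Qed.

(** For |x| > u the density of variance sigma^2 is at most
    sqrt 2 exp(- u^2 / (4 sigma^2)) times the density of variance 2 sigma^2: half
    of the exponent is spent on u, the other half is the wider Gaussian. *)
Lemma normal_tail (R : realType) (sigma u : R) : 0 < sigma -> 0 <= u ->
  (normal_prob 0%R sigma [set x | (u < `|x|)%R]
   <= (2 * expR (- (u ^+ 2 / (4 * sigma ^+ 2))))%:E)%E.
Proof.
move=> s0 u0; pose s' := Num.sqrt 2 * sigma.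
have r20 : 0 < Num.sqrt 2 :> R by rewrite sqrtr_gt0.
have s'0 : 0 < s' by rewrite mulr_gt0.
pose c := Num.sqrt 2 * expR (- (u ^+ 2 / (4 * sigma ^+ 2))).
have c0 : 0 <= c by rewrite mulr_ge0 ?expR_ge0// ltW.
have pdfE x : u < `|x| -> normal_pdf 0 sigma x <= c * normal_pdf 0 s' x.
  move=> ux; rewrite !normal_pdfE ?gt_eqF// /normal_peak /normal_fun !subr0.
  have -> : (s' ^+ 2 * pi *+ 2) = 2 * (sigma ^+ 2 * pi *+ 2).
    by rewrite /s' exprMn sqr_sqrtr//; ring.
  rewrite sqrtrM// invfM /c.
  set A := (Num.sqrt _)^-1; set B := (Num.sqrt _)^-1.
  rewrite (_ : _ * _ * (_ * _ * _) = (Num.sqrt 2 * B) * (A * (expR (- (u ^+ 2 / (4 *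
    sigma ^+ 2))) * expR (- x ^+ 2 / (s' ^+ 2 *+ 2))))); last by ring.
  rewrite mulfV ?gt_eqF// mul1r ler_wpM2l ?invr_ge0//.
  rewrite -expRD ler_expR.
  have -> : s' ^+ 2 *+ 2 = 4 * sigma ^+ 2 by rewrite /s' exprMn sqr_sqrtr//; ring.
  have -> : - x ^+ 2 / (sigma ^+ 2 *+ 2) = - (x ^+ 2 / (4 * sigma ^+ 2)) - (x ^+ 2 / (4
    * sigma ^+ 2)).
    by field; rewrite gt_eqF.
  rewrite mulNr lerD2r lerN2 ler_wpM2r ?invr_ge0 ?mulr_ge0 ?(ltW s0)//.
  by rewrite -[X in _ <= X]real_normK ?num_real// lerXn2r ?nnegrE// ltW.
have mA := measurable_normr_gt u.
rewrite /normal_prob.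
apply: (@le_trans _ _ (\int[lebesgue_measure]_(x in [set x | (u < `|x|)%R]) (c%:E *
  (normal_pdf 0%R s' x)%:E))%E).
  apply: ge0_le_integral => //.
  - by move=> x _; rewrite lee_fin normal_pdf_ge0.
  - apply/measurable_EFinP/measurable_funTS; exact: measurable_normal_pdf.
  - apply: emeasurable_funM => //; apply/measurable_EFinP/measurable_funTS;
    exact: measurable_normal_pdf.
apply: (@le_trans _ _ (\int[lebesgue_measure]_x (c%:E * (normal_pdf 0%R s' x)%:E))%E).
  apply: ge0_subset_integral => //.
  - apply: emeasurable_funM => //; apply/measurable_EFinP; exact: measurable_normal_pdf.
  - by move=> x _; rewrite -EFinM lee_fin mulr_ge0// normal_pdf_ge0.
rewrite ge0_integralZl//; last 2 first.
- by apply/measurable_EFinP; exact: measurable_normal_pdf.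
- by move=> x _; rewrite lee_fin normal_pdf_ge0.
rewrite integral_normal_pdf mule1 lee_fin ler_wpM2r ?expR_ge0//.
by rewrite -[leRHS]ger0_norm// -sqrtr_sqr ler_sqrt ?exprn_gt0//; lra.
Qed.

Lemma bm_tail (R : realType) (d : measure_display)
    (T : measurableType d) (P : probability T R) (B : R -> T -> R) (s t u : R) :
  brownian_motion P B -> 0 <= s -> s < t -> 0 <= u ->
  (P [set w | (u < `|B t w - B s w|)%R]
   <= (2 * expR (- (u ^+ 2 / (4 * (t - s)))))%:E)%E.
Proof.
move=> bm s0 st u0; have mA := measurable_normr_gt u.
rewrite (_ : [set w | _] = (fun w => B t w - B s w) @^-1` [set x | u < `|x|])//.
rewrite (bm_gaussian bm)// (le_trans (normal_tail _ _))// ?sqrtr_gt0 ?subr_gt0//.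
by rewrite sqr_sqrtr// subr_ge0 ltW.
Qed.

Lemma nneseries_geometric_lty (R : realType) (a : nat -> \bar R) (C r : R) :
  0 <= C -> 0 <= r < 1 -> (forall n, (0 <= a n)%E) ->
  (forall n, (a n <= (C * r ^+ n)%:E)%E) -> (\sum_(n <oo) a n < +oo)%E.
Proof.
move=> C0 /andP[r0 r1] a0 aC; apply: (@le_lt_trans _ _ (C / (1 - r))%:E);
  last exact: ltry.
apply: lime_le; first exact: is_cvg_nneseries.
apply: nearW => n; apply: (@le_trans _ _ (\sum_(0 <= k < n) (C * r ^+ k)%:E)%E).
  by apply: lee_sum => k _.
rewrite sumEFin lee_fin.
have -> : \sum_(0 <= k < n) C * r ^+ k = series (geometric C r) n by [].
rewrite geometric_seriesE ?lt_eqF//.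
rewrite ler_wpM2r ?invr_ge0 ?subr_ge0 ?(ltW r1)// ler_piMr// gerBl.
by rewrite exprn_ge0.
Qed.

(** Borel-Cantelli for a sequence of finite families of random variables: at
    stage [m] a union bound over [q m] variables, then summation over [m]. *)
Lemma ae_eventually_le (R : realType) (d : measure_display)
    (T : measurableType d) (P : probability T R)
    (X : nat -> nat -> T -> R) (u : nat -> nat -> R) (q : nat -> nat)
    (b : nat -> R) (C r : R) :
  (forall m k, measurable_fun [set: T] (X m k)) ->
  0 <= C -> 0 <= r < 1 ->
  (forall m k, (k < q m)%N -> (P [set w | (u m k < `|X m k w|)%R] <= (b m)%:E)%E) ->
  (forall m, (q m)%:R * b m <= C * r ^+ m) ->
  {ae P, forall w, exists M, forall m k, (M <= m)%N -> (k < q m)%N -> `|X m k w| <=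
    u m k}.
Proof.
move=> mX C0 r01 Pb qb.
pose E m k := [set w | u m k < `|X m k w|].
have mE m k : measurable (E m k).
  by have := mX m k measurableT _ (measurable_normr_gt (u m k)); rewrite setTI.
pose F m := \big[setU/set0]_(k < q m) E m k.
have mF m : measurable (F m) by apply: bigsetU_measurable.
have PF m : (P (F m) <= (C * r ^+ m)%:E)%E.
  apply: le_trans (Boole_inequality _ _) _; first by move=> i _; exact: mE.
  apply: (@le_trans _ _ (\sum_(k < q m) (b m)%:E)%E).
    by apply: lee_sum => k _; exact: Pb.
  by rewrite sumEFin lee_fin sumr_const card_ord -mulr_natl.
have := lim_sup_set_cvg0 mF (nneseries_geometric_lty C0 r01 (fun n =>
  measure_ge0 P (F n)) PF).
move=> PF0; exists (lim_sup_set F); split => //.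
  by apply: bigcapT_measurable => k; apply: bigcup_measurable.
apply: subsetCl => w /= nw.
have [M [_ HM]] : exists M, True /\ forall m, (M <= m)%N -> ~ F m w.
  apply: contrapT => h; apply: nw => M _; apply: contrapT => h'; apply: h.
  by exists M; split=> // m Mm Fm; apply: h'; exists m.
exists M => m k Mm km; rewrite leNgt; apply/negP => uX; apply: (HM m Mm).
by rewrite /F -bigcup_mkord; exists k.
Qed.

(** Only finitely many pairs escape an eventual bound, so a random factor makes
    it hold for all of them; the sum of the escaping ratios is such a factor. *)
Lemma ae_bounded_ratio (R : realType) (d : measure_display)
    (T : measurableType d) (P : probability T R)
    (X : nat -> nat -> T -> R) (u : nat -> nat -> R) (q : nat -> nat) :
  (forall m k, 0 < u m k) ->
  {ae P, forall w, exists M, forall m k, (M <= m)%N -> (k < q m)%N -> `|X m k w| <=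
    u m k} ->
  {ae P, forall w, exists2 A, 0 <= A & forall m k, (k < q m)%N -> `|X m k w| <=
    A * u m k}.
Proof.
move=> u0; apply: filterS => w [M HM].
have t0 m k : 0 <= `|X m k w| / u m k by rewrite divr_ge0// ltW.
have s0 m : 0 <= \sum_(k < q m) `|X m k w| / u m k by apply: sumr_ge0.
exists (1 + \sum_(m < M) \sum_(k < q m) `|X m k w| / u m k).
  by rewrite addr_ge0// sumr_ge0.
move=> m k kq; rewrite -ler_pdivrMr//; have [Mm|mM] := leqP M m.
  apply: (@le_trans _ _ 1); first by rewrite ler_pdivrMr// mul1r HM.
  by rewrite lerDl sumr_ge0.
rewrite (bigD1 (Ordinal mM))//= (bigD1 (Ordinal kq))//= addrCA -addrA lerDl.
apply: addr_ge0; first by apply: sumr_ge0.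
by apply: addr_ge0 => //; apply: sumr_ge0 => i _; exact: s0.
Qed.

(** Lévy's modulus of continuity at dyadic times, over the whole half-line.
    Stage m = n + N collects the increments of level N that start at n = m - N
    or later, for all N <= m.  An increment of level N has variance 2^(-N), so the threshold
    sqrt (28 (m + 1) / 2^N) is exceeded with probability at most
    2 exp(- 7 (m + 1)), which beats the at most 4^(m + 1) increments of a stage. *)
Lemma bm_dyadic_increments (R : realType) (d : measure_display)
    (T : measurableType d) (P : probability T R) (B : R -> T -> R) :
  brownian_motion P B ->
  {ae P, forall w, exists2 A, 0 <= A & forall n N i : nat, (i < 2 ^ N.+1)%N ->
    `|B (n%:R + i.+1%:R / 2 ^+ N) w - B (n%:R + i%:R / 2 ^+ N) w|
    <= A * Num.sqrt (28 * (n + N).+1%:R / 2 ^+ N)}.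
Proof.
move=> bm.
(* an index k at stage m encodes the level N and the position i as
   k = N * 2 ^ (m + 1) + i *)
pose lev m k := (k %/ 2 ^ m.+1)%N.
pose st m k : R := (m - lev m k)%:R + (k %% 2 ^ m.+1)%:R / 2 ^+ lev m k.
pose en m k : R := (m - lev m k)%:R + (k %% 2 ^ m.+1).+1%:R / 2 ^+ lev m k.
pose X m k w := B (en m k) w - B (st m k) w.
pose u m k : R := Num.sqrt (28 * m.+1%:R / 2 ^+ lev m k).
pose q m := (m.+1 * 2 ^ m.+1)%N.
have p2 N : 0 < 2 ^+ N :> R by rewrite exprn_gt0.
have st0 m k : 0 <= st m k by rewrite addr_ge0// divr_ge0// ltW.
have en0 m k : 0 <= en m k by rewrite addr_ge0// divr_ge0// ltW.
have sten m k : en m k - st m k = (2 ^+ lev m k)^-1.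
  by rewrite /en /st -natr1; field; rewrite gt_eqF.
have u0 m k : 0 < u m k by rewrite sqrtr_gt0 divr_gt0// mulr_gt0.
have ev : {ae P, forall w, exists M, forall m k, (M <= m)%N -> (k < q m)%N ->
  `|X m k w| <= u m k}.
  apply: (@ae_eventually_le R d T P X u q (fun m => 2 * expR (- (7 * m.+1%:R))) 1 2^-1).
  - by move=> m k; apply: measurable_funB; exact: (bm_measurable bm).
  - by [].
  - by rewrite invr_ge0 ler0n/= invf_lt1 ?ltr1n.
  - move=> m k kq; apply: le_trans (bm_tail bm (st0 m k) _ (ltW (u0 m k))) _.
      by rewrite -subr_gt0 sten invr_gt0.
    rewrite lee_fin ler_wpM2l// ler_expR lerN2 sten /u sqr_sqrtr; last first.
      by rewrite divr_ge0 ?mulr_ge0// ltW.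
    rewrite le_eqVlt; apply/orP; left; apply/eqP; field.
    by rewrite gt_eqF.
  - move=> m; rewrite mul1r.
    have e8 : expR (- 7) <= 8^-1 :> R.
      rewrite expRN lef_pV2 ?posrE ?expR_gt0//.
      by apply: le_trans (expR_ge1Dx _); lra.
    have -> : expR (- (7 * m.+1%:R)) = expR (-7) ^+ m.+1 :> R.
      by rewrite -expRM_natr mulNr.
    apply: (@le_trans _ _ ((2 ^ m.+1 * 2 ^ m.+1)%:R * (2 * 8^-1 ^+ m.+1))).
      apply: ler_pM => //.
        by rewrite ler_nat leq_mul2r ltnW ?orbT// ltn_expl.
      by rewrite ler_wpM2l// lerXn2r// ?nnegrE ?expR_ge0// invr_ge0.
    rewrite natrM natrX mulrCA -!exprMn.
    rewrite (_ : 2 * 2 * 8^-1 = 2^-1) ?exprS ?mulrA ?divff ?mul1r//; by field.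
apply: filterS (ae_bounded_ratio u0 (q := q) ev) => w [A A0 HA].
exists A => // n N i iN.
pose m := (n + N)%N; pose k := (N * 2 ^ m.+1 + i)%N.
have im : (i < 2 ^ m.+1)%N by rewrite (leq_trans iN)// leq_exp2l// ltnS leq_addl.
have levE : lev m k = N by rewrite /lev /k divnMDl ?expn_gt0// divn_small ?addn0.
have modE : (k %% 2 ^ m.+1)%N = i by rewrite /k modnMDl modn_small.
have kq : (k < q m)%N.
  rewrite /k /q mulSn addnC.
  by apply: (@leq_trans (2 ^ m.+1 + N * 2 ^ m.+1));
    rewrite ?ltn_add2r// leq_add2l leq_mul2r leq_addl orbT.
have := HA m k kq.
by rewrite /X /u /en /st levE modE addnK.
Qed.

(** The variance of B n - B 0 is n, so exceeding eps n has probability at most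
    2 exp(- eps^2 n / 4), which is summable.  The eventual bound holds with
    factor 1, which keeps [eps] deterministic. *)
Lemma bm_sublinear (R : realType) (d : measure_display)
    (T : measurableType d) (P : probability T R) (B : R -> T -> R) (eps : R) :
  brownian_motion P B -> 0 < eps ->
  {ae P, forall w, exists A, forall n : nat, `|B n%:R w| <= A + eps * n%:R}.
Proof.
move=> bm e0.
pose X m (k : nat) w := B m.+1%:R w - B 0 w.
pose r := expR (- (eps ^+ 2 / 4)).
have ev : {ae P, forall w, exists M, forall m k, (M <= m)%N -> (k < 1)%N ->
  `|X m k w| <= eps * m.+1%:R}.
  apply: (@ae_eventually_le R d T P X (fun m _ => eps * m.+1%:R) (fun=> 1%N) (fun m =>
    2 * r ^+ m.+1) 2 r).
  - by move=> m k; apply: measurable_funB; exact: (bm_measurable bm).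
  - by [].
  - by rewrite expR_ge0 expR_lt1 oppr_lt0 divr_gt0// exprn_gt0.
  - move=> m k _; apply: le_trans (bm_tail bm (lexx 0) _ _) _ => //.
      by rewrite mulr_ge0// ltW.
    rewrite lee_fin ler_wpM2l// /r -expRM_natr ler_expR.
    rewrite le_eqVlt; apply/orP; left; apply/eqP; rewrite subr0; field.
    by rewrite addrC natr1 pnatr_eq0.
  - move=> m; rewrite mul1r ler_wpM2l// exprS ler_piMl ?exprn_ge0 ?expR_ge0//.
    by rewrite ltW// expR_lt1 oppr_lt0 divr_gt0// exprn_gt0.
apply: filterS ev => w [M HM].
exists (`|B 0 w| + \sum_(n < M.+1) `|B n%:R w|) => n.
have [nM|Mn] := leqP n M.
  have nM' : (n < M.+1)%N by [].
  rewrite (bigD1 (Ordinal nM'))//= addrCA -addrA lerDl.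
  by rewrite addr_ge0 ?mulr_ge0 ?(ltW e0)// addr_ge0// sumr_ge0.
case: n Mn => // n Mn; have := HM n 0%N Mn isT; rewrite /X => Xn.
rewrite -[X in `|X|](subrK (B 0 w)) (le_trans (ler_normD _ _))// addrC.
by rewrite -addrA lerD// (le_trans Xn)// lerDr sumr_ge0.
Qed.

(** * Dyadic chaining *)

(** Consecutive dyadic approximations of a point from below agree or differ by
    one step of the finer grid. *)
Lemma truncn_double (R : realType) (x : R) (N : nat) : 0 <= x ->
  Num.truncn (x * 2 ^+ N.+1) = (Num.truncn (x * 2 ^+ N)).*2 \/
  Num.truncn (x * 2 ^+ N.+1) = (Num.truncn (x * 2 ^+ N)).*2.+1.
Proof.
move=> x0; have y0 : 0 <= x * 2 ^+ N by rewrite mulr_ge0// exprn_ge0.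
have y0' : 0 <= x * 2 ^+ N.+1 by rewrite mulr_ge0// exprn_ge0.
have /andP[] := truncn_itv y0; have /andP[] := truncn_itv y0'.
set k' := Num.truncn _; set k := Num.truncn _.
rewrite exprS [2 * _]mulrC mulrA; set y := x * _ => h1 h2 h3 h4.
have a1 : (k.*2 < k'.+1)%N by rewrite -(ltr_nat R) -muln2 natrM; lra.
have a2 : (k' < k.+1.*2)%N by rewrite -(ltr_nat R) -muln2 natrM; lra.
move: a1 a2; rewrite doubleS ltnS => a1 a2.
have [->|ne] := eqVneq k' k.*2; [by left|right; apply/eqP].
by rewrite eqn_leq -ltnS a2/= ltn_neqAle eq_sym ne a1.
Qed.

Lemma powR2N_lt1 (R : realType) (alpha : R) : 0 < alpha -> 2 `^ (- alpha) < 1 :> R.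
Proof.
move=> a0; rewrite powRN invf_lt1 ?powR_gt0// /powR gt_eqF//.
by rewrite expR_gt1 mulr_gt0// ln_gt0// ltr1n.
Qed.

(** Chaining: if the increments of [g] between neighbouring points of the grid of
    mesh 2^(-N) are at most D theta^N, then g x is reached from the value at the
    dyadic approximation of x by a telescoping sum dominated by a geometric
    series, and two points at distance at most 2^(-N) have equal or neighbouring
    approximations at level N. *)
Section chaining.
Variables (R : realType) (g : R -> R) (D theta : R).
Hypothesis (D0 : 0 <= D) (theta0 : 0 < theta) (theta1 : theta < 1).
Hypothesis cg : forall x : R, 0 <= x <= 2 -> forall eps : R, 0 < eps ->
  exists2 del : R, 0 < del & forall y : R, 0 <= y <= 2 -> `|x - y| < del ->
    `|g x - g y| <= eps.
Hypothesis step : forall N i, (i < 2 ^ N.+1)%N ->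
  `|g (i.+1%:R / 2 ^+ N) - g (i%:R / 2 ^+ N)| <= D * theta ^+ N.

Let dy N (x : R) : R := (Num.truncn (x * 2 ^+ N))%:R / 2 ^+ N.
Let S := D / (1 - theta).

Let p2 (N : nat) : 0 < 2 ^+ N :> R. Proof. by rewrite exprn_gt0. Qed.

Let S0 : 0 <= S. Proof. by rewrite divr_ge0// subr_ge0 ltW. Qed.

Let dyE N (x : R) : 0 <= x -> dy N x <= x < dy N x + (2 ^+ N)^-1.
Proof.
move=> x0; rewrite /dy ler_pdivrMr//.
rewrite -[X in _ + X]mul1r -mulrDl ltr_pdivlMr// natr1.
by rewrite truncn_itv// mulr_ge0// ltW.
Qed.

Let dy0 N (x : R) : 0 <= x <= 2 -> 0 <= dy N x <= 2.
Proof.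
move=> /andP[x0 x2]; rewrite divr_ge0 ?(ltW (p2 _))//=.
by have /andP[h _] := dyE N x0; rewrite (le_trans h).
Qed.

Let truncn_dyadic_le N (x : R) : 0 <= x <= 2 -> (Num.truncn (x * 2 ^+ N) <= 2 ^ N.+1)%N.
Proof.
move=> /andP[x0 x2]; rewrite -(ler_nat R) natrX exprS.
have /andP[h _] := truncn_itv (mulr_ge0 x0 (ltW (p2 N))).
by rewrite (le_trans h)// ler_wpM2r// ltW.
Qed.

Let dy_step N (x : R) : 0 <= x <= 2 -> `|g (dy N.+1 x) - g (dy N x)| <=
  D * theta ^+ N.+1.
Proof.
move=> x02; have /andP[x0 x2] := x02.
have E : dy N x = ((Num.truncn (x * 2 ^+ N)).*2)%:R / 2 ^+ N.+1.
  by rewrite /dy -muln2 natrM exprS; field; rewrite gt_eqF.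
rewrite E /dy; have [->|e] := truncn_double N x0.
  by rewrite subrr normr0 mulr_ge0// exprn_ge0// ltW.
by rewrite e step// -e truncn_dyadic_le.
Qed.

Let dy_chain N k (x : R) : 0 <= x <= 2 ->
  `|g (dy (N + k) x) - g (dy N x)| <= S * (theta ^+ N - theta ^+ (N + k)).
Proof.
move=> x02; elim: k => [|k IH]; first by rewrite addn0 !subrr normr0 mulr0.
rewrite addnS -(subrK (g (dy (N + k) x)) (g (dy (N + k).+1 x))) -addrA.
apply: (le_trans (ler_normD _ _)); apply: (le_trans (lerD (dy_step _ x02) IH)).
rewrite -lerBrDr -mulrBr opprB addrC addrA subrK.
rewrite (_ : S * _ = D * theta ^+ (N + k)); last first.
  by rewrite /S exprS; field; rewrite subr_eq0 gt_eqF.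
by rewrite exprS ler_wpM2l// ler_piMl ?(ltW theta1)// exprn_ge0// ltW.
Qed.

Let dy_lim N (x : R) : 0 <= x <= 2 -> `|g x - g (dy N x)| <= S * theta ^+ N.
Proof.
move=> x02; have /andP[x0 x2] := x02.
apply/ler_addgt0Pr => eps eps0; have [del del0 Hdel] := cg x02 eps0.
have [k Hk] : exists k : nat, (2 ^+ k)^-1 < del.
  exists (Num.bound del^-1); rewrite -[ltRHS]invrK ltf_pV2 ?posrE ?invr_gt0//.
  exact: upper_nthrootP.
rewrite (_ : g x - g (dy N x) =
  (g (dy (N + k) x) - g (dy N x)) + (g x - g (dy (N + k) x))); last by ring.
apply: (le_trans (ler_normD _ _)); rewrite lerD//.
  apply: (le_trans (dy_chain N k x02)); rewrite ler_wpM2l// gerBl.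
  by rewrite exprn_ge0// ltW.
apply: Hdel; first exact: dy0.
have /andP[h1 h2] := dyE (N + k) x0.
rewrite ger0_norm ?subr_ge0// (lt_trans _ Hk)//.
rewrite ltrBlDl (lt_le_trans h2)// lerD2l lef_pV2 ?posrE//.
by rewrite ler_eXn2l ?ltr1n// leq_addl.
Qed.

Lemma dyadic_chaining N (s t : R) : 0 <= s -> s <= t -> t <= 2 -> t - s <=
  (2 ^+ N)^-1 ->
  `|g t - g s| <= 3 * S * theta ^+ N.
Proof.
move=> s0 st t2 ts.
have s02 : 0 <= s <= 2 by rewrite s0 (le_trans st).
have t02 : 0 <= t <= 2 by rewrite t2 (le_trans s0).
have th0 : 0 <= theta ^+ N by rewrite exprn_ge0// ltW.
have mid : `|g (dy N t) - g (dy N s)| <= S * theta ^+ N.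
  apply: (@le_trans _ _ (D * theta ^+ N)); last first.
    by rewrite ler_wpM2r// ler_pdivlMr ?subr_gt0// ler_piMr// gerBl ltW.
  have ij : (Num.truncn (s * 2 ^+ N) <= Num.truncn (t * 2 ^+ N))%N.
    by apply: le_truncn; rewrite ler_wpM2r// ltW.
  have ji : (Num.truncn (t * 2 ^+ N) <= (Num.truncn (s * 2 ^+ N)).+1)%N.
    have /andP[_ h1] := truncn_itv (mulr_ge0 s0 (ltW (p2 N))).
    have /andP[h2 _] := truncn_itv (mulr_ge0 (andP t02).1 (ltW (p2 N))).
    rewrite -ltnS -(ltr_nat R) (le_lt_trans h2)//.
    apply: (@le_lt_trans _ _ (s * 2 ^+ N + 1)); last by rewrite -[ltRHS]natr1 ltrD2r.
    by rewrite -lerBlDl -mulrBl -ler_pdivlMr// mul1r.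
  rewrite /dy; have [->|ne] := eqVneq (Num.truncn (t * 2 ^+ N)) (Num.truncn (s * 2 ^+
    N)).
    by rewrite subrr normr0 mulr_ge0.
  have e : Num.truncn (t * 2 ^+ N) = (Num.truncn (s * 2 ^+ N)).+1.
    by apply/eqP; rewrite eqn_leq ji ltn_neqAle eq_sym ne ij.
  by rewrite e step// -e truncn_dyadic_le.
have hs := dy_lim N s02; have ht := dy_lim N t02.
rewrite (_ : g t - g s = (g t - g (dy N t)) + (g (dy N t) - g (dy N s)) - (g s - g (dy
  N s))); last by ring.
rewrite (le_trans (ler_normB _ _))//.
have := ler_normD (g t - g (dy N t)) (g (dy N t) - g (dy N s)).
by move: mid hs ht; lra.
Qed.

End chaining.

(** For theta = 2^(-alpha), choose the level N with
    2^(-N-1) < |s - t| <= 2^(-N); then theta^N <= 2 |s - t|^alpha. *)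
Lemma dyadic_holder (R : realType) (g : R -> R) (D alpha : R) :
  0 <= D -> 0 < alpha <= 1 ->
  (forall x : R, 0 <= x <= 2 -> forall eps : R, 0 < eps ->
    exists2 del : R, 0 < del & forall y : R, 0 <= y <= 2 -> `|x - y| < del ->
      `|g x - g y| <= eps) ->
  (forall N i, (i < 2 ^ N.+1)%N ->
    `|g (i.+1%:R / 2 ^+ N) - g (i%:R / 2 ^+ N)| <= D * (2 `^ (- alpha)) ^+ N) ->
  forall s t : R, 0 <= s <= 2 -> 0 <= t <= 2 -> `|s - t| <= 1 ->
  `|g s - g t| <= 6 * (D / (1 - 2 `^ (- alpha))) * `|s - t| `^ alpha.
Proof.
move=> D0 /andP[a0 a1] cg step.
have th0 : 0 < 2 `^ (- alpha) :> R by rewrite powR_gt0.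
have th1 := powR2N_lt1 a0.
suff main (s t : R) : 0 <= s -> s < t -> t <= 2 -> t - s <= 1 ->
    `|g t - g s| <= 6 * (D / (1 - 2 `^ (- alpha))) * (t - s) `^ alpha.
  move=> s t /andP[s0 s2] /andP[t0 t2] st1; have [st|ts|->] := ltgtP s t.
  - rewrite distrC [`|s - t|]distrC [X in X `^ alpha]gtr0_norm ?subr_gt0//.
    by apply: main => //; move: st1; rewrite ler_norml; lra.
  - rewrite [X in X `^ alpha]gtr0_norm ?subr_gt0//.
    by apply: main => //; move: st1; rewrite ler_norml; lra.
  - rewrite !subrr normr0 !mulr_ge0 ?powR_ge0// invr_ge0 subr_ge0; exact: ltW.
move=> s0 st t2 ts1; have ts0 : 0 < t - s by rewrite subr_gt0.
have ex : exists k, (2 ^+ k.+1)^-1 < t - s.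
  exists (Num.bound (t - s)^-1);
    rewrite -[ltRHS]invrK ltf_pV2 ?posrE ?invr_gt0 ?exprn_gt0//.
  apply: lt_trans (upper_nthrootP (leqnn _)) _.
  by rewrite ltr_eXn2l ?ltr1n.
case: (ex_minnP ex) => N HN Nmin.
have tsN : t - s <= (2 ^+ N)^-1.
  case: N HN Nmin => [|N] HN Nmin; first by rewrite expr0 invr1.
  by rewrite leNgt; apply/negP => /Nmin; rewrite ltnn.
have := dyadic_chaining D0 th0 th1 cg step s0 (ltW st) t2 tsN.
set S := D / _; have S0 : 0 <= S by rewrite divr_ge0// subr_ge0 ltW.
move=> /le_trans; apply.
have e : (2 `^ (- alpha)) ^+ N <= 2 * (t - s) `^ alpha :> R.
  have h : ((2 ^+ N.+1)^-1) `^ alpha <= (t - s) `^ alpha.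
    by rewrite ge0_ler_powR ?nnegrE ?(ltW a0) ?(ltW ts0) ?(ltW HN)// invr_ge0 exprn_ge0.
  apply: le_trans (ler_wpM2l (ler0n _ 2) h).
  have -> : (2 ^+ N.+1)^-1 `^ alpha = (2 `^ (- alpha)) ^+ N * 2 `^ (- alpha) :> R.
    rewrite -exprSr -powR_mulrn ?powR_ge0// -powRrM -powR_inv1 ?exprn_ge0//
      -powR_mulrn//.
    by rewrite -!powRrM; congr (_ `^ _); ring.
  rewrite mulrCA ler_peMr ?exprn_ge0 ?(ltW th0)//.
  rewrite powRN ler_pdivlMr ?powR_gt0// mul1r.
  by rewrite -[leRHS]powRr1// ler_powR// ler1n.
rewrite (_ : 6 * S * _ = 3 * S * (2 * (t - s) `^ alpha)); last by ring.
by rewrite ler_wpM2l// mulr_ge0.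
Qed.

(** * Local Hölder bounds with quadratic decay *)

(** Peetre's inequality for the weight 1 + x^2, written for the inverse weights. *)
Lemma peetre (R : realType) (x y : R) :
  (oneDsqr y)^-1 <= 2 * oneDsqr (x - y) / oneDsqr x.
Proof.
rewrite ler_pdivlMr ?oneDsqr_gt0// -ler_pdivlMl ?invr_gt0 ?oneDsqr_gt0// invrK.
rewrite /oneDsqr; have : 0 <= (x - 2 * y) ^+ 2 by exact: sqr_ge0.
have : 0 <= y ^+ 2 * (x - y) ^+ 2 by rewrite mulr_ge0 ?sqr_ge0.
set z := y ^+ 2 * _ => z0 h;
  have -> : (1 + y ^+ 2) * (2 * (1 + (x - y) ^+ 2)) = 2 + 2 * y ^+ 2 + 2 * (x - y) ^+ 2
    + 2 * z by rewrite /z; ring.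
by nra.
Qed.

(** The form of [weighted_holder] that can be checked region by region: only
    points at distance at most 1 are compared, so that the weights at the two
    points are comparable. *)
Definition local_holder (R : realType) (alpha D : R) (I : set R) (f : R -> R) :=
  (forall x, I x -> `|f x| <= D / oneDsqr x) /\
  (forall x y, I x -> I y -> `|x - y| <= 1 ->
    `|f y - f x| <= D * `|x - y| `^ alpha / oneDsqr x).

Lemma oneDsqrV_near (R : realType) (x y : R) : `|x - y| <= 1 ->
  (oneDsqr y)^-1 <= 4 / oneDsqr x.
Proof.
move=> xy; rewrite (le_trans (peetre x y))// ler_wpM2r// ?invr_ge0//.
have -> : 4 = 2 * (1 + 1) :> R by ring.
rewrite ler_wpM2l// /oneDsqr lerD2l -[X in X <= _]real_normK ?num_real//.
by rewrite expr_le1.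
Qed.

(** A pair of points on opposite sides of [a] is compared through [a], which lies
    between them. *)
Lemma local_holder_glue (R : realType) (alpha D1 D2 a : R) (f : R -> R) :
  0 < alpha -> 0 <= D1 -> 0 <= D2 ->
  local_holder alpha D1 [set x | x <= a] f ->
  local_holder alpha D2 [set x | a <= x] f ->
  local_holder alpha (4 * (D1 + D2)) [set: R] f.
Proof.
move=> a0 D10 D20 [b1 h1] [b2 h2].
have le1 : D1 <= 4 * (D1 + D2) by lra.
have le2 : D2 <= 4 * (D1 + D2) by lra.
have w0 (x : R) : 0 <= (oneDsqr x)^-1 by rewrite invr_ge0.
split=> [x _|x y _ _ xy1].
  have [xa|ax] := leP x a; first by rewrite (le_trans (b1 x xa))// ler_wpM2r.
  by rewrite (le_trans (b2 x (ltW ax)))// ler_wpM2r.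
have P0 (z : R) : 0 <= z `^ alpha by exact: powR_ge0.
have mono (D D' z z' : R) : 0 <= D -> D <= D' -> `|z| <= `|z'| ->
    D * `|z| `^ alpha / oneDsqr x <= D' * `|z'| `^ alpha / oneDsqr x.
  move=> D0 DD' zz; rewrite ler_wpM2r// ler_pM// ge0_ler_powR ?nnegrE ?(ltW a0)//.
have cross (D D' : R) : 0 <= D -> 0 <= D' -> `|x - a| <= `|x - y| -> `|a - y| <=
  `|x - y| ->
    `|f a - f x| <= D * `|x - a| `^ alpha / oneDsqr x ->
    `|f y - f a| <= D' * `|a - y| `^ alpha / oneDsqr a ->
    `|f y - f x| <= 4 * (D + D') * `|x - y| `^ alpha / oneDsqr x.
  move=> D0 D'0 xa ay H1 H2.
  rewrite (_ : f y - f x = (f y - f a) + (f a - f x)); last by ring.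
  rewrite (le_trans (ler_normD _ _))//.
  have H1' := le_trans H1 (mono D D _ _ D0 (lexx _) xa).
  have H2' : `|f y - f a| <= (4 * D') * `|x - y| `^ alpha / oneDsqr x.
    apply: le_trans H2 _; apply: (@le_trans _ _ (D' * `|a - y| `^ alpha * (4 / oneDsqr
      x))).
      by rewrite ler_wpM2l ?mulr_ge0// oneDsqrV_near// (le_trans xa).
    rewrite (_ : D' * _ * _ = 4 * D' * `|a - y| `^ alpha / oneDsqr x); last by ring.
    by apply: mono => //; rewrite mulr_ge0.
  apply: le_trans (lerD H2' H1') _; rewrite -mulrDl -mulrDl ler_wpM2r// ler_wpM2r//;
    lra.
have [xa|ax] := leP x a; have [ya|ay] := leP y a.
- by apply: le_trans (h1 x y xa ya xy1) _; exact: mono.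
- apply: cross => //.
  + by rewrite !ler0_norm ?subr_le0 ?(le_trans xa (ltW ay))//; lra.
  + by rewrite !ler0_norm ?subr_le0 ?(le_trans xa (ltW ay)) ?(ltW ay)//; lra.
  + apply: h1 => //=; apply: le_trans xy1;
    rewrite !ler0_norm ?subr_le0 ?(le_trans xa (ltW ay))//; lra.
  + apply: h2 => //=; first exact: ltW. 
    apply: le_trans xy1; rewrite !ler0_norm ?subr_le0 ?(le_trans xa (ltW ay)) ?(ltW
      ay)//; lra.
- rewrite [D1 + D2]addrC; apply: cross => //.
  + by rewrite !ger0_norm ?subr_ge0 ?(le_trans ya (ltW ax)) ?(ltW ax)//; lra.
  + by rewrite !ger0_norm ?subr_ge0 ?(le_trans ya (ltW ax)) ?(ltW ax)//; lra.
  + apply: h2 => //=; first exact: ltW.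
    apply: le_trans xy1; rewrite !ger0_norm ?subr_ge0 ?(le_trans ya (ltW ax)) ?(ltW
      ax)//; lra.
  + apply: h1 => //=.
    apply: le_trans xy1; rewrite !ger0_norm ?subr_ge0 ?(le_trans ya (ltW ax)) ?(ltW
      ax)//; lra.
- by apply: le_trans (h2 x y (ltW ax) (ltW ay) xy1) _; exact: mono.
Qed.

(** At distance more than 1 the Hölder factor exceeds 1, and the decay of the
    values alone gives the bound after moving the weight. *)
Lemma local_holder_weighted (R : realType) (alpha D : R) (f : R -> R) :
  0 < alpha -> 0 <= D -> local_holder alpha D [set: R] f ->
  weighted_holder alpha (3 * D) f.
Proof.
move=> a0 D0 [b h].
have w0 (x : R) : 0 <= (oneDsqr x)^-1 by rewrite invr_ge0.
split=> [x|x y].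
  by apply: le_trans (b x I) _; rewrite ler_wpM2r//; lra.
have P0 : 0 <= `|x - y| `^ alpha by exact: powR_ge0.
have [xy1|xy1] := leP `|x - y| 1.
  apply: le_trans (h x y I I xy1) _; rewrite ler_wpM2r//.
  rewrite -[leLHS]mulr1 ler_pM ?mulr_ge0 ?oneDsqr_ge1// ler_wpM2r//; lra.
have P1 : 1 <= `|x - y| `^ alpha.
  apply: (@le_trans _ _ (1 `^ alpha)); first by rewrite powR1.
  by rewrite ge0_ler_powR ?nnegrE ?(ltW a0) ?(ltW xy1).
rewrite (le_trans (ler_normB _ _))//; apply: le_trans (lerD (b y I) (b x I)) _.
apply: (@le_trans _ _ (D * (2 * oneDsqr (x - y) / oneDsqr x) + D * (oneDsqr (x - y) /
  oneDsqr x))).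
  rewrite lerD ?ler_wpM2l ?peetre//.
  by rewrite ler_peMl ?oneDsqr_ge1.
rewrite (_ : D * _ + _ = 3 * D * 1 * oneDsqr (x - y) / oneDsqr x); last by ring.
by rewrite !ler_wpM2r// ?ler_wpM2l ?mulr_ge0// (le_trans _ (oneDsqr_ge1 _)).
Qed.

(** * Path regularity *)

Lemma within_continuous_eps_delta (R : realType) (f : R -> R) (x eps : R) :
  {within `[0, +oo[, continuous f} -> 0 <= x -> 0 < eps ->
  exists2 del : R, 0 < del & forall y : R, 0 <= y -> `|x - y| < del -> `|f x - f y| <=
    eps.
Proof.
move=> /subspace_continuousP cf x0 e0.
have /cf : `[0, +oo[%classic x by rewrite /= in_itv/= x0.
move=> /(@cvgrPdist_le R R^o) /(_ _ e0)[del /= del0 H].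
exists del => // y y0 xy; apply: H => //=; by rewrite in_itv/= y0.
Qed.

(** The room between alpha and 1/2 absorbs the logarithmic loss: the quotient of
    2^(-N) by 2^(-2 alpha N) decays exponentially in N and beats the factor
    N + 1, while n + N + 1 <= (n + 1) (N + 1) separates the dependence on n. *)
Lemma levy_threshold_le (R : realType) (alpha : R) : alpha < 1 / 2 ->
  exists2 K : R, 0 <= K & forall n N : nat,
    Num.sqrt (28 * (n + N).+1%:R / 2 ^+ N)
    <= K * Num.sqrt n.+1%:R * (2 `^ (- alpha)) ^+ N.
Proof.
move=> a12.
(* 2 ^ (1 - 2 alpha) = exp lam, and exp (N lam) >= 1 + N lam beats N + 1 *)
pose lam : R := (1 - 2 * alpha) * ln 2.
have lam0 : 0 < lam by rewrite mulr_gt0 ?ln_gt0 ?ltr1n//; lra.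
pose K := 28 * (1 + lam^-1).
have c0 : 0 <= 1 + lam^-1 by rewrite addr_ge0// invr_ge0 ltW.
have K0 : 0 <= K by rewrite mulr_ge0.
exists (Num.sqrt K) => [//|n N].
have th0 : 0 <= (2 `^ (- alpha)) ^+ N :> R by rewrite exprn_ge0// powR_ge0.
rewrite -sqrtrM// -[X in _ <= _ * X]ger0_norm// -sqrtr_sqr -sqrtrM ?mulr_ge0//.
rewrite ler_sqrt ?mulr_ge0 ?exprn_ge0//.
have e1 : ((2 `^ (- alpha)) ^+ N) ^+ 2 = expR (N%:R * lam) / 2 ^+ N :> R.
  have -> : 2 ^+ N = expR (N%:R * ln 2) :> R by rewrite expRM_natl lnK// posrE.
  rewrite -expRN -expRD -exprM /powR gt_eqF// -expRM_natl natrM; congr expR.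
  by rewrite /lam; ring.
rewrite e1 mulrA ler_wpM2r ?invr_ge0 ?exprn_ge0//.
have e2 : N%:R + 1 <= (1 + lam^-1) * expR (N%:R * lam).
  apply: (@le_trans _ _ ((1 + lam^-1) * (1 + N%:R * lam))); last first.
    by rewrite ler_wpM2l ?expR_ge1Dx.
  rewrite (_ : _ * _ = N%:R + 1 + (lam^-1 + N%:R * lam)); last by field; rewrite gt_eqF.
  by rewrite lerDl; apply: addr_ge0;
    [rewrite invr_ge0 ltW|rewrite mulr_ge0 ?(ltW lam0)].
rewrite (_ : K * _ * _ = 28 * (n.+1%:R * ((1 + lam^-1) * expR (N%:R * lam))));
  last by rewrite /K; ring.
rewrite ler_wpM2l//; apply: le_trans (ler_wpM2l (ler0n _ n.+1) e2).
by rewrite natr1 -natrM ler_nat mulSn mulnS addnA addSn [(N + n)%N]addnC leq_addr.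
Qed.

(** Intervals of length 2 rather than 1: any two points at distance at most 1 lie
    in a common [n, n + 2], so that no splitting at integers is needed. *)
Lemma path_holder (R : realType) (b : R -> R) (A alpha : R) :
  0 < alpha < 1 / 2 -> 0 <= A ->
  {within `[0, +oo[, continuous b} ->
  (forall n N i : nat, (i < 2 ^ N.+1)%N ->
    `|b (n%:R + i.+1%:R / 2 ^+ N) - b (n%:R + i%:R / 2 ^+ N)|
    <= A * Num.sqrt (28 * (n + N).+1%:R / 2 ^+ N)) ->
  exists2 H : R, 0 <= H & forall (n : nat) (s t : R),
    n%:R <= s <= n%:R + 2 -> n%:R <= t <= n%:R + 2 -> `|s - t| <= 1 ->
    `|b s - b t| <= H * Num.sqrt n.+1%:R * `|s - t| `^ alpha.
Proof.
move=> /andP[a0 a12] A0 cb incr.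
have [K K0 HK] := levy_threshold_le a12.
have a01 : 0 < alpha <= 1 by rewrite a0; lra.
have th1 := powR2N_lt1 a0.
exists (6 * (A * K / (1 - 2 `^ (- alpha)))).
  by rewrite mulr_ge0// divr_ge0 ?mulr_ge0// subr_ge0 ltW.
move=> n s t /andP[s0 s2] /andP[t0 t2] st.
have n0 : 0 <= n%:R :> R by [].
pose g x := b (n%:R + x).
have D0 : 0 <= A * (K * Num.sqrt n.+1%:R) by rewrite !mulr_ge0.
have cg : forall x : R, 0 <= x <= 2 -> forall eps : R, 0 < eps ->
    exists2 del : R, 0 < del & forall y : R, 0 <= y <= 2 -> `|x - y| < del ->
      `|g x - g y| <= eps.
  move=> x /andP[x0 x2] eps e0.
  have [del del0 Hd] := within_continuous_eps_delta cb (addr_ge0 n0 x0) e0.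
  exists del => // y /andP[y0 y2] xy; apply: Hd; first exact: addr_ge0.
  by rewrite (_ : _ - _ = x - y)//; ring.
have stp : forall N i, (i < 2 ^ N.+1)%N ->
    `|g (i.+1%:R / 2 ^+ N) - g (i%:R / 2 ^+ N)| <=
      A * (K * Num.sqrt n.+1%:R) * (2 `^ (- alpha)) ^+ N.
  move=> N i iN; apply: le_trans (incr n N i iN) _.
  by rewrite -[leRHS]mulrA ler_wpM2l.
have := dyadic_holder D0 a01 cg stp (s := s - n%:R) (t := t - n%:R).
rewrite /g !subrKC opprB addrA subrK.
rewrite (_ : 6 * _ * Num.sqrt _ = 6 * (A * (K * Num.sqrt n.+1%:R) / (1 - 2 `^ (-
  alpha)))); last by ring.
by apply => //; apply/andP; lra.
Qed.

(** * The extended geometric Brownian motion *)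

Lemma expR_lipschitz (R : realType) (x y m : R) : x <= m -> y <= m ->
  `|expR x - expR y| <= expR m * `|x - y|.
Proof.
wlog xy : x y / x <= y => [wh|] xm ym.
  by have [/wh->//|/ltW/wh yx] := leP x y; rewrite distrC [X in _ * X]distrC yx.
rewrite ler0_norm ?subr_le0 ?ler_expR// opprB ler0_norm ?subr_le0// opprB.
have -> : expR y - expR x = expR y * (1 - expR (x - y)).
  by rewrite mulrBr mulr1 -expRD subrKC.
apply: (@le_trans _ _ (expR y * (y - x))).
  by rewrite ler_wpM2l ?expR_ge0//; have := expR_ge1Dx (x - y); lra.
by rewrite ler_wpM2r ?subr_ge0// ler_expR.
Qed.

(** Cube the bound exp(k s / 3) >= 1 + k s / 3, using
    (1 + 3 / k) (1 + k s / 3) >= 1 + s. *)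
Lemma expR_beats_cube (R : realType) (k : R) : 0 < k ->
  exists2 K : R, 0 <= K & forall s, 0 <= s -> expR (- (k * s)) * (1 + s) ^+ 3 <= K.
Proof.
move=> k0; exists ((1 + 3 / k) ^+ 3).
  by rewrite exprn_ge0// addr_ge0// divr_ge0// ltW.
move=> s s0; rewrite expRN -ler_pdivlMl ?invr_gt0 ?expR_gt0// invrK.
have -> : expR (k * s) = expR (k * s / 3) ^+ 3 by rewrite -expRM_natr; congr expR;
  field.
rewrite -exprMn lerXn2r ?nnegrE ?addr_ge0//.
  by rewrite mulr_ge0 ?expR_ge0// addr_ge0// divr_ge0// ltW.
apply: (@le_trans _ _ ((1 + k * s / 3) * (1 + 3 / k))).
  rewrite (_ : _ * _ = 1 + s + (3 / k + k * s / 3)); last by field; rewrite gt_eqF.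
  by rewrite lerDl addr_ge0// divr_ge0// ?mulr_ge0// ltW.
by rewrite ler_wpM2r ?expR_ge1Dx// addr_ge0// divr_ge0// ltW.
Qed.

Lemma le_powR_of_le1 (R : realType) (a x : R) : 0 < a <= 1 -> 0 <= x <= 1 -> x <=
  x `^ a.
Proof.
move=> /andP[a0 a1] /andP[x0 x1]; have [->|xn0] := eqVneq x 0; first exact: powR_ge0.
by rewrite -[leLHS]powRr1// ger_powR// lt_neqAle eq_sym xn0 x0.
Qed.

(** With q = sqrt (n + 1) and n the integer part of t, the exponent at t is at
    most 2 c A + 2 c H q - c^2 t, and 2 c H q <= 2 H^2 + c^2 q^2 / 2 leaves the
    decay exp(- c^2 t / 2).  It dominates the factor 1 + t that comes from the
    Hölder constants as well as the quadratic weight. *)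
Lemma gbm_local_holder (R : realType) (b : R -> R) (c alpha A H : R) :
  0 < c -> 0 < alpha <= 1 -> 0 <= H ->
  (forall (n : nat) (s t : R),
    n%:R <= s <= n%:R + 2 -> n%:R <= t <= n%:R + 2 -> `|s - t| <= 1 ->
    `|b s - b t| <= H * Num.sqrt n.+1%:R * `|s - t| `^ alpha) ->
  (forall n : nat, `|b n%:R| <= A + c / 2 * n%:R) ->
  exists2 D, 0 <= D & local_holder alpha D [set t | 0 <= t]
    (fun t => expR (- (2 * (c * b t)) - 2 * c ^+ 2 * t)).
Proof.
move=> c0 a01 H0 Hb Ab; have /andP[a0 a1] := a01.
pose a t := - (2 * (c * b t)) - 2 * c ^+ 2 * t.
pose k := c ^+ 2 / 2; pose E := 2 * c * A + 2 * H ^+ 2 + k.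
have k0 : 0 < k by rewrite divr_gt0// exprn_gt0.
have [K K0 HK] := expR_beats_cube k0.
have sq (n : nat) : [/\ 0 <= Num.sqrt n.+1%:R :> R,
  Num.sqrt n.+1%:R ^+ 2 = n%:R + 1 :> R & Num.sqrt n.+1%:R <= n%:R + 1 :> R].
  have q2 : Num.sqrt n.+1%:R ^+ 2 = n%:R + 1 :> R by rewrite sqr_sqrtr// natr1.
  split=> //; rewrite -q2 expr2 ler_peMl// -[leLHS](@sqrtr1 R) ler_sqrt//.
  by rewrite ler1n.
have aE t : 0 <= t -> a t <= E - k * t.
  move=> t0; have /andP[nt tn] := truncn_itv t0; set n := Num.truncn t in nt tn.
  rewrite -natr1 in tn.
  have [q0 q2 _] := sq n; set q := Num.sqrt _ in q0 q2.
  have bt : `|b t| <= A + c / 2 * n%:R + H * q.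
    rewrite -(subrK (b n%:R) (b t)) (le_trans (ler_normD _ _))// addrC lerD//.
    have t1 : `|t - n%:R| <= 1 by rewrite ger0_norm ?subr_ge0//; lra.
    apply: le_trans (Hb n t n%:R _ _ t1) _; [by apply/andP; lra|by apply/andP; lra|].
    rewrite ler_piMr ?mulr_ge0//.
    apply: (@le_trans _ _ (1 `^ alpha)); last by rewrite powR1.
    by rewrite ge0_ler_powR ?nnegrE ?(ltW a0).
  have bt' : - b t <= A + c / 2 * n%:R + H * q.
    by apply: le_trans bt; rewrite -normrN ler_norm.
  have h1 : 2 * c * (- b t) <= 2 * c * (A + c / 2 * n%:R + H * q).
    by rewrite ler_wpM2l// mulr_ge0// ltW.
  have h2 : 0 <= (c * q - 2 * H) ^+ 2 by exact: sqr_ge0.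
  have h3 : c ^+ 2 * q ^+ 2 <= c ^+ 2 * (t + 1) by rewrite ler_wpM2l ?sqr_ge0// q2; lra.
  have h4 : c ^+ 2 * n%:R <= c ^+ 2 * t by rewrite ler_wpM2l ?sqr_ge0.
  rewrite /a /E /k; move: h1 h2 h3 h4; nra.
have cube (s : R) : 0 <= s -> oneDsqr s <= (1 + s) ^+ 2.
  by move=> s0; rewrite /oneDsqr; nra.
have decay (s : R) : 0 <= s -> expR (E - k * s) * (1 + s) <= expR E * K / oneDsqr s.
  move=> s0; rewrite ler_pdivlMr ?oneDsqr_gt0// expRD.
  rewrite -[_ * (1 + s)]mulrA -[leLHS]mulrA -[_ * _ * oneDsqr s]mulrA.
  rewrite ler_wpM2l ?expR_ge0//.
  apply: le_trans (HK s s0); rewrite ler_wpM2l ?expR_ge0// exprS ler_wpM2l ?cube//.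
  by rewrite addr_ge0.
pose G := 2 * c * H + 2 * c ^+ 2.
have G0 : 0 <= G by rewrite addr_ge0 ?mulr_ge0 ?sqr_ge0 ?(ltW c0).
have core s t : 0 <= s -> s <= t -> t - s <= 1 ->
    `|expR (a t) - expR (a s)| <= G * (expR E * K) * `|t - s| `^ alpha / oneDsqr s.
  move=> s0 st ts1; have t0 := le_trans s0 st.
  have ts : 0 <= `|t - s| <= 1 by rewrite normr_ge0 ger0_norm ?subr_ge0.
  have m1 : a t <= E - k * s.
    by apply: le_trans (aE t t0) _; rewrite lerD2l lerN2 ler_wpM2l// ltW.
  apply: le_trans (expR_lipschitz m1 (aE s s0)) _.
  have /andP[ns sn] := truncn_itv s0; set n := Num.truncn s in ns sn.
  rewrite -natr1 in sn.
  have [q0 _ q1] := sq n; set q := Num.sqrt _ in q0 q1.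
  have dat : `|a t - a s| <= G * (1 + s) * `|t - s| `^ alpha.
    rewrite (_ : a t - a s = - (2 * c * (b t - b s)) - 2 * c ^+ 2 * (t - s));
      last by rewrite /a; ring.
    rewrite (le_trans (ler_normB _ _))// normrN [`|2 * c * _|]normrM [`|2 * c ^+ 2 *
      _|]normrM.
    rewrite [`|2 * c|]ger0_norm ?mulr_ge0 ?(ltW c0)//.
    rewrite [`|2 * c ^+ 2|]ger0_norm ?mulr_ge0 ?(ltW c0)//.
    have P0 : 0 <= `|t - s| `^ alpha by exact: powR_ge0.
    have b1 : `|b t - b s| <= H * (1 + s) * `|t - s| `^ alpha.
      apply: le_trans (Hb n t s _ _ _) _; [by apply/andP; lra|by apply/andP;
        lra|by case/andP: ts|].
      by rewrite ler_wpM2r// ler_wpM2l// (le_trans q1)//; lra.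
    have b2 : `|t - s| <= (1 + s) * `|t - s| `^ alpha.
      by apply: le_trans (le_powR_of_le1 a01 ts) _; rewrite ler_peMl//; lra.
    have b1' : 2 * c * `|b t - b s| <= 2 * c * (H * (1 + s) * `|t - s| `^ alpha).
      by rewrite ler_wpM2l// mulr_ge0// ltW.
    have b2' : 2 * c ^+ 2 * `|t - s| <= 2 * c ^+ 2 * ((1 + s) * `|t - s| `^ alpha).
      by rewrite ler_wpM2l// mulr_ge0// sqr_ge0.
    apply: le_trans (lerD b1' b2') _; rewrite le_eqVlt; apply/orP; left; apply/eqP.
    by rewrite /G; ring.
  apply: le_trans (ler_wpM2l (expR_ge0 _) dat) _.
  rewrite [leLHS](_ : _ = G * `|t - s| `^ alpha * (expR (E - k * s) * (1 + s)));
    last by ring.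
  rewrite [leRHS](_ : _ = G * `|t - s| `^ alpha * (expR E * K / oneDsqr s));
    last by ring.
  by rewrite ler_wpM2l ?decay// mulr_ge0// powR_ge0.
have D10 : 0 <= expR E * K by rewrite mulr_ge0// expR_ge0.
have D20 : 0 <= G * (expR E * K) by rewrite mulr_ge0.
exists (expR E * K + 4 * (G * (expR E * K))); first by rewrite addr_ge0// mulr_ge0.
split=> [s s0|x y x0 y0 xy] /=.
  rewrite ger0_norm ?expR_ge0//.
  apply: (@le_trans _ _ (expR (E - k * s) * (1 + s))).
    apply: (@le_trans _ _ (expR (E - k * s))); first by rewrite ler_expR aE.
    by rewrite ler_peMr ?expR_ge0// lerDl.
  apply: le_trans (decay s s0) _; rewrite ler_wpM2r ?invr_ge0// lerDl mulr_ge0//.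
have P0 : 0 <= `|x - y| `^ alpha by exact: powR_ge0.
have [lxy|lyx] := leP x y.
  apply: (@le_trans _ _ (G * (expR E * K) * `|x - y| `^ alpha / oneDsqr x)).
    rewrite [X in X `^ _]distrC; apply: core => //.
    by move: xy; rewrite distrC ger0_norm// subr_ge0.
  by rewrite ler_wpM2r ?invr_ge0// ler_wpM2r//; lra.
have yx1 : x - y <= 1 by move: xy; rewrite ger0_norm// subr_ge0 ltW.
rewrite distrC; apply: le_trans (core y x y0 (ltW lyx) yx1) _.
apply: (@le_trans _ _ (G * (expR E * K) * `|x - y| `^ alpha * (4 / oneDsqr x))).
  by rewrite ler_wpM2l ?mulr_ge0 ?oneDsqrV_near.
rewrite [leLHS](_ : _ = 4 * (G * (expR E * K)) * `|x - y| `^ alpha / oneDsqr x);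
  last by ring.
by rewrite ler_wpM2r ?invr_ge0// ler_wpM2r// lerDr.
Qed.

Lemma maxr0_lipschitz (R : realType) (p q : R) :
  `|Num.max 0 p - Num.max 0 q| <= `|p - q|.
Proof.
wlog pq : p q / p <= q => [wh|].
  by have [/wh//|/ltW/wh] := leP p q; rewrite distrC [leRHS]distrC.
rewrite ler0_norm ?subr_le0; last by rewrite ge_max !le_max lexx/= pq orbT.
rewrite ler0_norm ?subr_le0// !opprB.
by have [p0|p0] := leP 0 p; have [q0|q0] := leP 0 q; lra.
Qed.

(** To the left of [t0], both remaining branches of psi are the single formula
    e0 max(0, c^2 (x - t0) + 1), which is Lipschitz with bounded support; a
    Lipschitz bound implies the alpha-Hölder bound at distances at most 1, and on
    a bounded set the weight is bounded below. *)
Lemma psi_local_holder (R : realType) (b : R -> R) (c t0 alpha D : R) :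
  0 < c -> 0 <= t0 -> 0 < alpha <= 1 -> 0 <= D ->
  local_holder alpha D [set t | 0 <= t]
    (fun t => expR (- (2 * (c * b t)) - 2 * c ^+ 2 * t)) ->
  exists2 D', 0 <= D' & local_holder alpha D' [set: R] (psi c t0 (fun t => c * b t)).
Proof.
move=> c0 t00 a01 D0 [hb hh]; have /andP[a0 a1] := a01.
set f := psi _ _ _; pose e0 := expR (- (2 * (c * b t0)) - 2 * c ^+ 2 * t0).
have e00 : 0 <= e0 by exact: expR_ge0.
have c20 : 0 < c ^+ 2 by rewrite exprn_gt0.
have fl x : x <= t0 -> f x = e0 * Num.max 0 (c ^+ 2 * (x - t0) + 1).
  move=> xt; rewrite /f /psi; have [tx|_] := leP t0 x.
    have -> : x = t0 by apply/eqP; rewrite eq_le xt.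
    by rewrite subrr mulr0 add0r max_r// mulr1.
  have key : (- (1 / c ^+ 2) + t0 <= x) = (0 <= c ^+ 2 * (x - t0) + 1).
    rewrite -lerBlDr sub0r -ler_pdivrMl// mulrN1 mulrC; lra.
  by rewrite key; case: ifPn => h; [rewrite max_r|rewrite max_l ?mulr0// ltW// ltNge].
pose L := `|t0| + (c ^+ 2)^-1 + 1.
have L0 : 0 <= L by rewrite !addr_ge0// invr_ge0 ltW.
pose W := 1 + L ^+ 2.
have W0 : 0 <= W by rewrite addr_ge0// sqr_ge0.
pose D1 := e0 * (1 + c ^+ 2) * W.
have D10 : 0 <= D1 by rewrite !mulr_ge0// addr_ge0// ltW.
have far x : x < t0 - (c ^+ 2)^-1 -> Num.max 0 (c ^+ 2 * (x - t0) + 1) = 0.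
  move=> h; rewrite max_l// -lerBrDr sub0r -ler_pdivlMl// mulrN1; lra.
have near x : x <= t0 -> t0 - (c ^+ 2)^-1 - 1 <= x -> 1 <= W / oneDsqr x.
  move=> xt hx; rewrite ler_pdivlMr ?oneDsqr_gt0// mul1r /oneDsqr /W lerD2l.
  rewrite -[X in X <= _]real_normK ?num_real// lerXn2r ?nnegrE//.
  have h1 := ler_norm t0; have h2 : - t0 <= `|t0| by rewrite -normrN ler_norm.
  have h3 : 0 <= (c ^+ 2)^-1 by rewrite invr_ge0 ltW.
  by rewrite ler_norml /L; apply/andP; lra.
have lip x y : x <= t0 -> y <= t0 -> `|f y - f x| <= e0 * c ^+ 2 * `|x - y|.
  move=> xt yt; rewrite !fl// -mulrBr normrM ger0_norm// -mulrA ler_wpM2l//.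
  set p := c ^+ 2 * (y - t0) + 1; set q := c ^+ 2 * (x - t0) + 1.
  have -> : c ^+ 2 * `|x - y| = `|p - q|.
    by rewrite distrC -[X in X * _](gtr0_norm c20) -normrM /p /q; congr `|_|; ring.
  exact: maxr0_lipschitz.
have left : local_holder alpha D1 [set x | x <= t0] f.
  split=> [x xt|x y xt yt xy] /=.
    rewrite fl//; have [h|h] := ltP x (t0 - (c ^+ 2)^-1).
      by rewrite far// mulr0 normr0 divr_ge0.
    rewrite normrM ger0_norm// /D1 -[leRHS]mulrA -[leRHS]mulrA ler_wpM2l//.
    have m1 : `|Num.max 0 (c ^+ 2 * (x - t0) + 1)| <= 1.
      rewrite ger0_norm ?le_max ?lexx// ge_max ler01/= -lerBrDr subrr.
      by rewrite pmulr_rle0// subr_le0.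
    apply: le_trans m1 _; apply: (@le_trans _ _ (1 * (W / oneDsqr x))).
      by rewrite mul1r near//; move: h; lra.
    by rewrite ler_wpM2r ?divr_ge0// lerDl ltW.
  have [h|h] := ltP (Num.max x y) (t0 - (c ^+ 2)^-1).
    move: h; rewrite gt_max => /andP[h1 h2].
    rewrite (fl y yt) (fl x xt) (far x h1) (far y h2) subrr normr0.
    by apply: divr_ge0 => //; apply: mulr_ge0 => //; exact: powR_ge0.
  have hx : t0 - (c ^+ 2)^-1 - 1 <= x.
    by move: h xy; rewrite le_max ler_norml => /orP[]; lra.
  apply: le_trans (lip x y xt yt) _.
  have xa : `|x - y| <= `|x - y| `^ alpha by apply: le_powR_of_le1; rewrite ?normr_ge0.
  rewrite [leRHS](_ : _ = e0 * (1 + c ^+ 2) * `|x - y| `^ alpha * (W / oneDsqr x));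
    last by rewrite /D1; ring.
  have ec : 0 <= e0 * c ^+ 2 by rewrite mulr_ge0// ltW.
  have ecx : 0 <= e0 * c ^+ 2 * `|x - y| := mulr_ge0 ec (normr_ge0 _).
  rewrite -[leLHS]mulr1; apply: ler_pM; rewrite ?near//.
  by apply: ler_pM => //; rewrite ler_wpM2l// lerDr.
have fr x : t0 <= x -> f x = expR (- (2 * (c * b x)) - 2 * c ^+ 2 * x).
  by move=> tx; rewrite /f /psi tx.
have right : local_holder alpha D [set x | t0 <= x] f.
  split=> [x xt|x y xt yt xy] /=; rewrite !fr//; first by apply: hb; exact: le_trans xt.
  by apply: hh => //=; [exact: le_trans xt|exact: le_trans yt].
exists (4 * (D1 + D)); first by rewrite mulr_ge0// addr_ge0.
exact: local_holder_glue left right.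
Qed.

(** * Besov regularity of the extended geometric Brownian motion *)

Theorem lemma8p3 (R : realType) (d : measure_display) (T : measurableType d)
    (P : probability T R) (beta : R -> T -> R) (c t0 : R)
    (rho : R -> R) (alpha : R) (p : \bar R)
    (hbeta : brownian_motion P beta) (hc : 0 < c) (ht0 : 0 <= t0)
    (hrho : lp_cutoff rho) (halpha0 : 0 < alpha) (halpha1 : alpha < 1 / 2)
    (hp : (1 <= p)%E) :
  {ae P, forall w, in_besov rho alpha p (psi c t0 (fun t => c * beta t w))}.
Proof.
have a01 : 0 < alpha <= 1 by rewrite halpha0/=; lra.
have a12 : 0 < alpha < 1 / 2 by rewrite halpha0.
have incr := bm_dyadic_increments hbeta.
have growth := bm_sublinear hbeta (divr_gt0 hc (ltr0Sn R 1)).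
apply: filterS3 incr growth (bm_continuous hbeta).
move=> w [A A0 HA] [A' HA'] cw.
have [H H0 HH] := path_holder a12 A0 cw HA.
have [D D0 HD] := gbm_local_holder hc a01 H0 HH HA'.
have [D' D'0 HD'] := psi_local_holder hc ht0 a01 D0 HD.
exact: weighted_holder_in_besov hrho a01 hp (local_holder_weighted halpha0 D'0 HD').
Qed.
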